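(* Let $R$ be a commutative ring, $\sigma\in\mathrm{Aut}(R)$ with $\sigma^p=\mathrm{Id}_R$, $\omega=\{\mathfrak m_0,\dots,\sigma^{p-1}(\mathfrak m_0)\}$ a $\sigma$-orbit in $\mathrm{MaxSpec}(R)$ with $p$ elements, and $t,t'\in R$ regular elements. Let $0\le i\le i'\le p-1$, $w=w_{i+1}\cdots w_{i+\ell}\in\mathbf D^t_\omega$, $w'=w'_{i'+1}\cdots w'_{i'+\ell'}\in\mathbf D^{t'}_\omega$ be such that $V=V^t(\omega,i,w)$ and $V'=V^{t'}(\omega,i',w')$ are defined. Suppose $\dim_{R/\sigma^{i'+1}(\mathfrak m_0)}V_{\sigma^{i'+1}(\mathfrak m_0)}=c$ and $\dim_{R/\sigma^{i+1}(\mathfrak m_0)}V'_{\sigma^{i+1}(\mathfrak m_0)}=c'$. Then, as $A(tt')$-modules, $$V\otimes_RV'\simeq\bigoplus_{j=0}^{c-1}V^{tt'}(\omega,i',(w')^{(j)})\oplus\bigoplus_{j=1}^{c'-\delta_{i,i'}}V^{tt'}(\omega,i,w^{(j)}),$$ where, with $m_j=\min\{i+\ell-i'-jp,\ \ell'\}$ and $n_j=\min\{\ell,\ i'+\ell'-i-jp\}$, $$(w')^{(j)}=(w_{i'+1+jp}\cdot w'_{i'+1})(w_{i'+2+jp}\cdot w'_{i'+2})\cdots(w_{i'+jp+m_j}\cdot w'_{i'+m_j}),$$ $$w^{(j)}=(w_{i+1}\cdot w'_{i+1+jp})(w_{i+2}\cdot w'_{i+2+jp})\cdots(w_{i+n_j}\cdot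 w'_{i+jp+n_j}),$$ with the convention that $(w')^{(j)}=\emptyset$ (resp. $w^{(j)}=\emptyset$) if $i+\ell=i'+jp$ (resp. $i'+\ell'=i+jp$), and more generally that a product of length $0$ is the empty word. The letters of $(w')^{(j)}$ are indexed starting from $i'+1$, those of $w^{(j)}$ starting from $i+1$.
   Context: $A(t)$ is the ring generated over $R$ by $X,Y$ with $Xr=\sigma(r)X$, $Yr=\sigma^{-1}(r)Y$ ($r\in R$), $YX=t$, $XY=\sigma(t)$. A weight module is an $A(t)$-module $M=\bigoplus_{\mathfrak m\in\mathrm{MaxSpec}(R)}M_{\mathfrak m}$, $M_{\mathfrak m}=\{v\mid\mathfrak mv=0\}$. For a weight $A(t)$-module $M$ and a weight $A(t')$-module $M'$, $M\otimes_RM'$ is an $A(tt')$-module via $X(v\otimes v')=Xv\otimes Xv'$, $Y(v\otimes v')=Yv\otimes Yv'$. $B^t_\omega=\{\mathfrak m\in\omega\mid t\in\mathfrak m\}$. $\mathbf D^t_\omega$ is the set of indexed words $w=w_jw_{j+1}\cdots w_{j+m}$ with letters $w_k\in\{1,x,y,0\}$ such that $w_k=1$ iff $\sigma^k(\mathfrak m_0)\notin B^t_\omega$. For $0\le i\le p-1$ with $\sigma^i(\mathfrak m_0)\in B^t_\omega$ and $w=w_{i+1}\cdots w_{i+\ell}\in\mathbf D^t_\omega$ ($\ell\ge0$; $\ell=0$ is the empty word) with $\sigma^{i+\ell+1}(\mathfrak m_0)\in B^t_\omega$, $V^t(\omega,i,w)=\bigoplus_{i+1\le k\le i+\ell+1}(R/\sigma^k(\mathfrak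 m_0))e_k$ with $Xe_k=\sigma(t)e_{k+1}$ if $k\ne i+\ell+1,w_k=1$; $e_{k+1}$ if $k\ne i+\ell+1,w_k=x$; $0$ if $k=i+\ell+1$ or $w_k\in\{y,0\}$; $Ye_k=e_{k-1}$ if $k\ne i+1,w_{k-1}\in\{1,y\}$; $0$ if $k=i+1$ or $w_{k-1}\in\{x,0\}$; and $X(rv)=\sigma(r)Xv$, $Y(rv)=\sigma^{-1}(r)Yv$. The set $\{0,1,x,y\}$ is a commutative monoid under $a\cdot a=a$, $a\cdot0=0$, $a\cdot1=a$, $x\cdot y=0$. $\delta_{i,i'}$ is the Kronecker delta. *)

(* Defs.v *)
From HB Require Import structures.
From mathcomp Require Import all_boot all_algebra.
From mathcomp Require Import generic_quotient ring_quotient boolp.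

Set Implicit Arguments.
Unset Strict Implicit.
Unset Printing Implicit Defensive.

Import GRing.Theory.
Local Open Scope ring_scope.
Local Open Scope quotient_scope.

Record ring_aut (R : comNzRingType) := RingAut {
  aut :> {rmorphism R -> R};
  autV : {rmorphism R -> R};
  autK : cancel aut autV;
  autVK : cancel autV aut }.

(* [idealr R] is the library type of proper ideals, so no condition
   [1 \notin m] is needed here. *)
Definition maximal_ideal (R : comNzRingType) (m : idealr R) : Prop :=
  forall J : idealr R, {subset m <= J} -> J =i m.

Section AutImage.
Variables (R : comNzRingType) (s : ring_aut R) (m : idealr R).

Definition aut_img : {pred R} := [pred r | autV s r \in m].

Lemma aut_imgP r : reflect (exists2 x, x \in m & r = s x) (r \in aut_img).
Proof.
apply: (iffP idP) => [|[x xm ->]]; rewrite inE; last by rewrite autK.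
by move=> rm; exists (autV s r); rewrite ?autVK.
Qed.

Lemma aut_img_closed : idealr_closed aut_img.
Proof.
split=> [||a x y]; rewrite !inE ?rmorph0 ?rmorph1 ?rpred0 ?idealr1 //.
by rewrite rmorphD rmorphM => xm ym; rewrite rpredD ?idealMr.
Qed.

HB.instance Definition _ := isIdealr.Build R aut_img aut_img_closed.

End AutImage.

Section Orbit.
Variables (R : comNzRingType) (s : ring_aut R) (m0 : idealr R).

(* The ideal sigma^k(m_0). *)
Definition orb (k : nat) : idealr R :=
  iter k (fun m : idealr R => aut_img s m : idealr R) m0.

Lemma mem_orbS k r : (r \in orb k.+1) = (autV s r \in orb k).
Proof. by []. Qed.

Lemma mem_orb_aut k r : (s r \in orb k.+1) = (r \in orb k).
Proof. by rewrite mem_orbS autK. Qed.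

(* Membership in omega and in B^t_omega: an ideal is a boolean predicate, so
   equality of ideals is extensional. *)
Definition omega (p : nat) (m : idealr R) : Prop :=
  exists2 k, (k < p)%N & m =i orb k.

Definition breaks (p : nat) (t : R) (m : idealr R) : Prop :=
  omega p m /\ t \in m.

End Orbit.

Section QuotMod.
Variables (R : comNzRingType) (I : idealr R).

Definition quot_scale (a : R) (x : {ideal_quot I}) : {ideal_quot I} :=
  \pi a * x.

Lemma quot_scaleA a b v : quot_scale a (quot_scale b v) = quot_scale (a * b) v.
Proof. by rewrite /quot_scale mulrA rmorphM. Qed.
Lemma quot_scale1 : left_id 1 quot_scale.
Proof. by move=> x; rewrite /quot_scale rmorph1 mul1r. Qed.
Lemma quot_scaleDr : right_distributive quot_scale +%R.
Proof. by move=> a x y; rewrite /quot_scale mulrDr. Qed.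
Lemma quot_scaleDl v : {morph quot_scale^~ v : a b / a + b}.
Proof. by move=> a b; rewrite /quot_scale rmorphD mulrDl. Qed.

HB.instance Definition _ := GRing.Zmodule_isLmodule.Build R {ideal_quot I}
  quot_scaleA quot_scale1 quot_scaleDr quot_scaleDl.

Lemma quot_eq (x y : R) :
  (\pi x = \pi y :> {ideal_quot I}) <-> (x - y \in I).
Proof.
by have E := Quotient.idealrBE I x y; split=> [/eqP|H]; last (apply/eqP);
  rewrite -?E // E.
Qed.

End QuotMod.

Section DirectSum.
Variables (S : pzRingType) (I : finType) (M : I -> lmodType S).

Definition dsum : Type := forall i, M i.

HB.instance Definition _ := gen_eqMixin dsum.
HB.instance Definition _ := gen_choiceMixin dsum.

Implicit Types f g h : dsum.
Definition dsum0 : dsum := fun i => 0.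
Definition dsum_opp f : dsum := fun i => - f i.
Definition dsum_add f g : dsum := fun i => f i + g i.
Definition dsum_scale (a : S) f : dsum := fun i => a *: f i.

Lemma dsumP f g : (forall i, f i = g i) -> f = g.
Proof. exact: functional_extensionality_dep. Qed.

Lemma dsum_addA : associative dsum_add.
Proof. by move=> f g h; apply: dsumP => i; apply: addrA. Qed.
Lemma dsum_addC : commutative dsum_add.
Proof. by move=> f g; apply: dsumP => i; apply: addrC. Qed.
Lemma dsum_add0 : left_id dsum0 dsum_add.
Proof. by move=> f; apply: dsumP => i; apply: add0r. Qed.
Lemma dsum_addN : left_inverse dsum0 dsum_opp dsum_add.
Proof. by move=> f; apply: dsumP => i; apply: addNr. Qed.

HB.instance Definition _ :=
  GRing.isZmodule.Build dsum dsum_addA dsum_addC dsum_add0 dsum_addN.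

Lemma dsum_scaleA a b f : dsum_scale a (dsum_scale b f) = dsum_scale (a * b) f.
Proof. by apply: dsumP => i; apply: scalerA. Qed.
Lemma dsum_scale1 : left_id 1 dsum_scale.
Proof. by move=> f; apply: dsumP => i; apply: scale1r. Qed.
Lemma dsum_scaleDr : right_distributive dsum_scale +%R.
Proof. by move=> a f g; apply: dsumP => i; apply: scalerDr. Qed.
Lemma dsum_scaleDl f : {morph dsum_scale^~ f : a b / a + b}.
Proof. by move=> a b; apply: dsumP => i; apply: scalerDl. Qed.

HB.instance Definition _ := GRing.Zmodule_isLmodule.Build S dsum
  dsum_scaleA dsum_scale1 dsum_scaleDr dsum_scaleDl.

End DirectSum.

(* M (x)_R N is the set of formal expressions in the symbols m (x) n modulo
   the least additive congruence making (x) biadditive and R-balanced. *)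
Section Tensor.
Variables (R : comNzRingType) (M N : lmodType R).

Inductive tterm : Type :=
  | TPure of M & N
  | TZero
  | TOpp of tterm
  | TAdd of tterm & tterm.

Inductive teq : tterm -> tterm -> Prop :=
  | teq_refl a : teq a a
  | teq_sym a b : teq a b -> teq b a
  | teq_trans a b c : teq a b -> teq b c -> teq a c
  | teq_opp a b : teq a b -> teq (TOpp a) (TOpp b)
  | teq_add a b c d : teq a b -> teq c d -> teq (TAdd a c) (TAdd b d)
  | teq_addA a b c : teq (TAdd a (TAdd b c)) (TAdd (TAdd a b) c)
  | teq_addC a b : teq (TAdd a b) (TAdd b a)
  | teq_add0 a : teq (TAdd TZero a) a
  | teq_addN a : teq (TAdd (TOpp a) a) TZero
  | teq_pureDl m m' n : teq (TPure (m + m') n) (TAdd (TPure m n) (TPure m' n))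
  | teq_pureDr m n n' : teq (TPure m (n + n')) (TAdd (TPure m n) (TPure m n'))
  | teq_pureZ r m n : teq (TPure (r *: m) n) (TPure m (r *: n)).

HB.instance Definition _ := gen_eqMixin tterm.
HB.instance Definition _ := gen_choiceMixin tterm.

Definition teqb (a b : tterm) : bool := `[< teq a b >].

Lemma teqb_equiv : equiv_class_of teqb.
Proof.
split=> [a|a b|b a c]; first exact/asboolP/teq_refl.
  by apply/asboolP/asboolP => /teq_sym.
by move=> /asboolP H /asboolP K; apply/asboolP/(teq_trans H K).
Qed.

Canonical teqb_equivRel := EquivRelPack teqb_equiv.

Definition tens : Type := {eq_quot teqb}.
HB.instance Definition _ : EqQuotient _ teqb tens := EqQuotient.on tens.
HB.instance Definition _ := Choice.on tens.

Definition tclass (a : tterm) : tens := \pi_tens a.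

Lemma tclassP a b : tclass a = tclass b <-> teq a b.
Proof.
split=> [/eqP|H]; last by apply/eqP; rewrite /tclass piE; apply/asboolP.
by rewrite /tclass piE => /asboolP.
Qed.

Lemma tclass_ind (P : tens -> Prop) :
  (forall a, P (tclass a)) -> forall x, P x.
Proof. by move=> H x; rewrite -[x]reprK; apply: H. Qed.

Lemma repr_tclass a : teq (repr (tclass a)) a.
Proof. by apply/tclassP; rewrite /tclass reprK. Qed.

Definition tens_add (x y : tens) : tens := tclass (TAdd (repr x) (repr y)).
Definition tens_opp (x : tens) : tens := tclass (TOpp (repr x)).
Definition tens0 : tens := tclass TZero.

Lemma tclassD a b : tens_add (tclass a) (tclass b) = tclass (TAdd a b).
Proof. by apply/tclassP/teq_add; apply: repr_tclass. Qed.
Lemma tclassN a : tens_opp (tclass a) = tclass (TOpp a).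
Proof. by apply/tclassP/teq_opp; apply: repr_tclass. Qed.

Lemma tens_addA : associative tens_add.
Proof.
elim/tclass_ind=> a; elim/tclass_ind=> b; elim/tclass_ind=> c.
by rewrite !tclassD; apply/tclassP/teq_addA.
Qed.
Lemma tens_addC : commutative tens_add.
Proof.
elim/tclass_ind=> a; elim/tclass_ind=> b.
by rewrite !tclassD; apply/tclassP/teq_addC.
Qed.
Lemma tens_add0 : left_id tens0 tens_add.
Proof. by elim/tclass_ind=> a; rewrite tclassD; apply/tclassP/teq_add0. Qed.
Lemma tens_addN : left_inverse tens0 tens_opp tens_add.
Proof.
by elim/tclass_ind=> a; rewrite tclassN tclassD; apply/tclassP/teq_addN.
Qed.

HB.instance Definition _ :=
  GRing.isZmodule.Build tens tens_addA tens_addC tens_add0 tens_addN.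

Definition pure (m : M) (n : N) : tens := tclass (TPure m n).

Lemma pureDl m m' n : pure (m + m') n = pure m n + pure m' n.
Proof. by rewrite [RHS]tclassD; apply/tclassP/teq_pureDl. Qed.
Lemma pureDr m n n' : pure m (n + n') = pure m n + pure m n'.
Proof. by rewrite [RHS]tclassD; apply/tclassP/teq_pureDr. Qed.
Lemma pure_balanced r m n : pure (r *: m) n = pure m (r *: n).
Proof. exact/tclassP/teq_pureZ. Qed.

Lemma tens_ind (P : tens -> Prop) :
    (forall m n, P (pure m n)) -> P 0 -> (forall x, P x -> P (- x)) ->
    (forall x y, P x -> P y -> P (x + y)) -> forall x, P x.
Proof.
move=> Pp P0 PN PD; elim/tclass_ind; elim=> [m n||a Pa|a Pa b Pb].
- exact: Pp.
- exact: P0.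
- by have := PN _ Pa; rewrite [- _]tclassN.
- by have := PD _ _ Pa Pb; rewrite [_ + _]tclassD.
Qed.

Section Lift.
Variables (Z : zmodType) (f : M -> N -> Z).
Hypothesis fDl : forall m m' n, f (m + m') n = f m n + f m' n.
Hypothesis fDr : forall m n n', f m (n + n') = f m n + f m n'.
Hypothesis fZ : forall r m n, f (r *: m) n = f m (r *: n).

Fixpoint tterm_eval (a : tterm) : Z :=
  match a with
  | TPure m n => f m n
  | TZero => 0
  | TOpp a => - tterm_eval a
  | TAdd a b => tterm_eval a + tterm_eval b
  end.

Lemma tterm_eval_eq a b : teq a b -> tterm_eval a = tterm_eval b.
Proof.
elim=> //= {a b}.
- by move=> a b c _ -> _ ->.
- by move=> a b _ ->.
- by move=> a b c d _ -> _ ->.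
- by move=> *; rewrite addrA.
- by move=> *; rewrite addrC.
- by move=> *; rewrite add0r.
- by move=> *; rewrite addNr.
Qed.

Definition tens_lift (x : tens) : Z := tterm_eval (repr x).

Lemma tens_lift_class a : tens_lift (tclass a) = tterm_eval a.
Proof. exact/tterm_eval_eq/repr_tclass. Qed.

Lemma tens_lift_pure m n : tens_lift (pure m n) = f m n.
Proof. exact: tens_lift_class. Qed.

Lemma tens_liftD x y : tens_lift (x + y) = tens_lift x + tens_lift y.
Proof.
elim/tclass_ind: x => a; elim/tclass_ind: y => b.
by rewrite [_ + _]tclassD !tens_lift_class.
Qed.

End Lift.

Lemma tens_ext (Z : zmodType) (g h : tens -> Z) :
    {morph g : x y / x + y} -> {morph h : x y / x + y} ->
    (forall m n, g (pure m n) = h (pure m n)) -> g =1 h.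
Proof.
have add0 (k : tens -> Z) : {morph k : x y / x + y} -> k 0 = 0.
  by move=> kD; apply: (addrI (k 0)); rewrite -kD !addr0.
have addN (k : tens -> Z) : {morph k : x y / x + y} -> {morph k : x / - x}.
  move=> kD x; apply: (addrI (k x)).
  by rewrite -kD !subrr (add0 _ kD).
move=> gD hD gh; elim/tens_ind=> [||x gx|x y gx gy]; first exact: gh.
- by rewrite !add0.
- by rewrite !addN // gx.
- by rewrite gD hD gx gy.
Qed.

Definition tens_scale (r : R) : tens -> tens :=
  tens_lift (fun m n => pure (r *: m) n).

Lemma tens_scale_pure r m n : tens_scale r (pure m n) = pure (r *: m) n.
Proof.
apply: tens_lift_pure => [m1 m2 n1|m1 n1 n2|a m1 n1].
- by rewrite scalerDr pureDl.
- by rewrite pureDr.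
- by rewrite -pure_balanced !scalerA mulrC.
Qed.

Lemma tens_scaleDr : right_distributive tens_scale +%R.
Proof.
move=> r x y; apply: tens_liftD => [m1 m2 n1|m1 n1 n2|a m1 n1].
- by rewrite scalerDr pureDl.
- by rewrite pureDr.
- by rewrite -pure_balanced !scalerA mulrC.
Qed.

Lemma tens_scaleA a b x : tens_scale a (tens_scale b x) = tens_scale (a * b) x.
Proof.
move: x; apply: tens_ext => [x y|x y|m n]; rewrite ?tens_scaleDr //.
by rewrite !tens_scale_pure scalerA.
Qed.
Lemma tens_scale1 : left_id 1 tens_scale.
Proof.
apply: tens_ext => [x y|x y|m n]; rewrite ?tens_scaleDr //.
by rewrite !tens_scale_pure scale1r.
Qed.
Lemma tens_scaleDl x : {morph tens_scale^~ x : a b / a + b}.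
Proof.
move=> a b; move: x.
apply: (tens_ext (h := fun x => tens_scale a x + tens_scale b x)) => [x y|x y|m n].
- by rewrite tens_scaleDr.
- by rewrite !tens_scaleDr addrACA.
- by rewrite !tens_scale_pure scalerDl pureDl.
Qed.

HB.instance Definition _ := GRing.Zmodule_isLmodule.Build R tens
  tens_scaleA tens_scale1 tens_scaleDr tens_scaleDl.

Lemma pureZ r m n : r *: pure m n = pure (r *: m) n.
Proof. exact: tens_scale_pure. Qed.

End Tensor.

(* A(t) is the set of formal ring expressions in the elements of R and in X, Y
   modulo the least congruence containing the ring axioms, the relations of R,
   and the defining relations of A(t). *)
Section GWA.
Variables (R : comNzRingType) (s : ring_aut R) (t : R).

Inductive gterm : Type :=
  | GConst of R
  | GX
  | GY
  | GOpp of gterm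
  | GAdd of gterm & gterm
  | GMul of gterm & gterm.

Inductive geq : gterm -> gterm -> Prop :=
  | geq_refl a : geq a a
  | geq_sym a b : geq a b -> geq b a
  | geq_trans a b c : geq a b -> geq b c -> geq a c
  | geq_opp a b : geq a b -> geq (GOpp a) (GOpp b)
  | geq_add a b c d : geq a b -> geq c d -> geq (GAdd a c) (GAdd b d)
  | geq_mul a b c d : geq a b -> geq c d -> geq (GMul a c) (GMul b d)
  | geq_addA a b c : geq (GAdd a (GAdd b c)) (GAdd (GAdd a b) c)
  | geq_addC a b : geq (GAdd a b) (GAdd b a)
  | geq_add0 a : geq (GAdd (GConst 0) a) a
  | geq_addN a : geq (GAdd (GOpp a) a) (GConst 0)
  | geq_mulA a b c : geq (GMul a (GMul b c)) (GMul (GMul a b) c)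
  | geq_mul1l a : geq (GMul (GConst 1) a) a
  | geq_mul1r a : geq (GMul a (GConst 1)) a
  | geq_mulDl a b c : geq (GMul (GAdd a b) c) (GAdd (GMul a c) (GMul b c))
  | geq_mulDr a b c : geq (GMul a (GAdd b c)) (GAdd (GMul a b) (GMul a c))
  | geq_constD r r' : geq (GConst (r + r')) (GAdd (GConst r) (GConst r'))
  | geq_constM r r' : geq (GConst (r * r')) (GMul (GConst r) (GConst r'))
  | geq_Xr r : geq (GMul GX (GConst r)) (GMul (GConst (s r)) GX)
  | geq_Yr r : geq (GMul GY (GConst r)) (GMul (GConst (autV s r)) GY)
  | geq_YX : geq (GMul GY GX) (GConst t)
  | geq_XY : geq (GMul GX GY) (GConst (s t)).

HB.instance Definition _ := gen_eqMixin gterm.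
HB.instance Definition _ := gen_choiceMixin gterm.

Definition geqb (a b : gterm) : bool := `[< geq a b >].

Lemma geqb_equiv : equiv_class_of geqb.
Proof.
split=> [a|a b|b a c]; first exact/asboolP/geq_refl.
  by apply/asboolP/asboolP => /geq_sym.
by move=> /asboolP H /asboolP K; apply/asboolP/(geq_trans H K).
Qed.

Canonical geqb_equivRel := EquivRelPack geqb_equiv.

Definition gwa : Type := {eq_quot geqb}.
HB.instance Definition _ : EqQuotient _ geqb gwa := EqQuotient.on gwa.
HB.instance Definition _ := Choice.on gwa.

Definition gclass (a : gterm) : gwa := \pi_gwa a.

Lemma gclassP a b : gclass a = gclass b <-> geq a b.
Proof.
split=> [/eqP|H]; last by apply/eqP; rewrite /gclass piE; apply/asboolP.
by rewrite /gclass piE => /asboolP.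
Qed.

Lemma gclass_ind (P : gwa -> Prop) :
  (forall a, P (gclass a)) -> forall x, P x.
Proof. by move=> H x; rewrite -[x]reprK; apply: H. Qed.

Lemma repr_gclass a : geq (repr (gclass a)) a.
Proof. by apply/gclassP; rewrite /gclass reprK. Qed.

Definition gwa_add (x y : gwa) : gwa := gclass (GAdd (repr x) (repr y)).
Definition gwa_mul (x y : gwa) : gwa := gclass (GMul (repr x) (repr y)).
Definition gwa_opp (x : gwa) : gwa := gclass (GOpp (repr x)).
Definition gwa0 : gwa := gclass (GConst 0).
Definition gwa1 : gwa := gclass (GConst 1).

Lemma gclassD a b : gwa_add (gclass a) (gclass b) = gclass (GAdd a b).
Proof. by apply/gclassP/geq_add; apply: repr_gclass. Qed.
Lemma gclassM a b : gwa_mul (gclass a) (gclass b) = gclass (GMul a b).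
Proof. by apply/gclassP/geq_mul; apply: repr_gclass. Qed.
Lemma gclassN a : gwa_opp (gclass a) = gclass (GOpp a).
Proof. by apply/gclassP/geq_opp; apply: repr_gclass. Qed.

Let gE := (gclassD, gclassM, gclassN).

Lemma gwa_addA : associative gwa_add.
Proof.
elim/gclass_ind=> a; elim/gclass_ind=> b; elim/gclass_ind=> c.
by rewrite !gE; apply/gclassP/geq_addA.
Qed.
Lemma gwa_addC : commutative gwa_add.
Proof.
elim/gclass_ind=> a; elim/gclass_ind=> b.
by rewrite !gE; apply/gclassP/geq_addC.
Qed.
Lemma gwa_add0 : left_id gwa0 gwa_add.
Proof. by elim/gclass_ind=> a; rewrite !gE; apply/gclassP/geq_add0. Qed.
Lemma gwa_addN : left_inverse gwa0 gwa_opp gwa_add.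
Proof. by elim/gclass_ind=> a; rewrite !gE; apply/gclassP/geq_addN. Qed.
Lemma gwa_mulA : associative gwa_mul.
Proof.
elim/gclass_ind=> a; elim/gclass_ind=> b; elim/gclass_ind=> c.
by rewrite !gE; apply/gclassP/geq_mulA.
Qed.
Lemma gwa_mul1l : left_id gwa1 gwa_mul.
Proof. by elim/gclass_ind=> a; rewrite !gE; apply/gclassP/geq_mul1l. Qed.
Lemma gwa_mul1r : right_id gwa1 gwa_mul.
Proof. by elim/gclass_ind=> a; rewrite !gE; apply/gclassP/geq_mul1r. Qed.
Lemma gwa_mulDl : left_distributive gwa_mul gwa_add.
Proof.
elim/gclass_ind=> a; elim/gclass_ind=> b; elim/gclass_ind=> c.
by rewrite !gE; apply/gclassP/geq_mulDl.
Qed.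
Lemma gwa_mulDr : right_distributive gwa_mul gwa_add.
Proof.
elim/gclass_ind=> a; elim/gclass_ind=> b; elim/gclass_ind=> c.
by rewrite !gE; apply/gclassP/geq_mulDr.
Qed.

HB.instance Definition _ := GRing.isPzRing.Build gwa
  gwa_addA gwa_addC gwa_add0 gwa_addN gwa_mulA gwa_mul1l gwa_mul1r
  gwa_mulDl gwa_mulDr.

Definition gX : gwa := gclass GX.
Definition gY : gwa := gclass GY.
Definition gC (r : R) : gwa := gclass (GConst r).

Lemma gCD : {morph gC : r r' / r + r'}.
Proof. by move=> r r'; rewrite [RHS]gclassD; apply/gclassP/geq_constD. Qed.
Lemma gCM : {morph gC : r r' / r * r'}.
Proof. by move=> r r'; rewrite [RHS]gclassM; apply/gclassP/geq_constM. Qed.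
Lemma gXC r : gX * gC r = gC (s r) * gX.
Proof. by rewrite [LHS]gclassM [RHS]gclassM; apply/gclassP/geq_Xr. Qed.
Lemma gYC r : gY * gC r = gC (autV s r) * gY.
Proof. by rewrite [LHS]gclassM [RHS]gclassM; apply/gclassP/geq_Yr. Qed.
Lemma gYX : gY * gX = gC t.
Proof. by rewrite [LHS]gclassM; apply/gclassP/geq_YX. Qed.
Lemma gXY : gX * gY = gC (s t).
Proof. by rewrite [LHS]gclassM; apply/gclassP/geq_XY. Qed.

End GWA.

Section Restriction.
Variables (R : comNzRingType) (s : ring_aut R) (t : R).
Variable M : lmodType (gwa s t).

(* The underlying R-module of an A(t)-module. *)
Definition resR : Type := M.
HB.instance Definition _ := GRing.Zmodule.on resR.

Definition res_scale (r : R) (v : resR) : resR := (gC s t r : gwa s t) *: (v : M).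

Lemma res_scaleA a b v : res_scale a (res_scale b v) = res_scale (a * b) v.
Proof. by rewrite /res_scale scalerA -gCM. Qed.
Lemma res_scale1 : left_id 1 res_scale.
Proof. by move=> v; apply: (@scale1r _ M). Qed.
Lemma res_scaleDr : right_distributive res_scale +%R.
Proof. by move=> a x y; apply: (@scalerDr _ M). Qed.
Lemma res_scaleDl v : {morph res_scale^~ v : a b / a + b}.
Proof. by move=> a b; rewrite /res_scale gCD; apply: (@scalerDl _ M). Qed.

HB.instance Definition _ := GRing.Zmodule_isLmodule.Build R resR
  res_scaleA res_scale1 res_scaleDr res_scaleDl.

End Restriction.

Section FromGenerators.
Variables (R : comNzRingType) (s : ring_aut R) (t : R).

Record gwa_rep := GwaRep {
  rep_mod :> lmodType R;
  repX : rep_mod -> rep_mod;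
  repY : rep_mod -> rep_mod;
  repXD : {morph repX : u v / u + v};
  repYD : {morph repY : u v / u + v};
  repXZ : forall r v, repX (r *: v) = s r *: repX v;
  repYZ : forall r v, repY (r *: v) = autV s r *: repY v;
  repYX : forall v, repY (repX v) = t *: v;
  repXY : forall v, repX (repY v) = s t *: v }.

Variable V : gwa_rep.

(* The A(t)-module defined by the action of the generators. *)
Definition gmod : Type := V.
HB.instance Definition _ := GRing.Zmodule.on gmod.

Fixpoint gterm_act (a : gterm R) (v : V) : V :=
  match a with
  | GConst r => r *: v
  | GX => repX v
  | GY => repY v
  | GOpp a => - gterm_act a v
  | GAdd a b => gterm_act a v + gterm_act b v
  | GMul a b => gterm_act a (gterm_act b v)
  end.

Lemma repX0 : repX (0 : V) = 0.
Proof. by apply: (addrI (repX (0 : V))); rewrite -repXD !addr0. Qed.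
Lemma repY0 : repY (0 : V) = 0.
Proof. by apply: (addrI (repY (0 : V))); rewrite -repYD !addr0. Qed.

Lemma gterm_actD a : {morph gterm_act a : u v / u + v}.
Proof.
elim: a => [r|||a IH|a IHa b IHb|a IHa b IHb] u v /=.
- exact: scalerDr.
- exact: repXD.
- exact: repYD.
- by rewrite IH opprD.
- by rewrite IHa IHb addrACA.
- by rewrite IHb IHa.
Qed.

Lemma gterm_act_eq a b : geq s t a b -> gterm_act a =1 gterm_act b.
Proof.
elim=> //= {a b}.
- by move=> a b _ IH v; rewrite IH.
- by move=> a b c _ IH1 _ IH2 v; rewrite IH1 IH2.
- by move=> a b _ IH v; rewrite IH.
- by move=> a b c d _ IH1 _ IH2 v; rewrite IH1 IH2.
- by move=> a b c d _ IH1 _ IH2 v; rewrite IH1 IH2.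
- by move=> a b c v; rewrite addrA.
- by move=> a b v; rewrite addrC.
- by move=> a v; rewrite scale0r add0r.
- by move=> a v; rewrite addNr scale0r.
- by move=> a v; rewrite scale1r.
- by move=> a v; rewrite scale1r.
- by move=> a b c v; rewrite gterm_actD.
- by move=> r r' v; rewrite scalerDl.
- by move=> r r' v; rewrite scalerA.
- by move=> r v; rewrite repXZ.
- by move=> r v; rewrite repYZ.
- by move=> v; rewrite repYX.
- by move=> v; rewrite repXY.
Qed.

Definition gmod_scale (x : gwa s t) (v : gmod) : gmod := gterm_act (repr x) v.

Lemma gmod_scale_class a v : gmod_scale (gclass s t a) v = gterm_act a v.
Proof. exact/gterm_act_eq/repr_gclass. Qed.

Lemma gmod_scaleA x y v :
  gmod_scale x (gmod_scale y v) = gmod_scale (x * y) v.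
Proof.
elim/gclass_ind: x => a; elim/gclass_ind: y => b.
by rewrite [_ * _]gclassM !gmod_scale_class.
Qed.
Lemma gmod_scale1 : left_id 1 gmod_scale.
Proof. by move=> v; rewrite [LHS]gmod_scale_class /= scale1r. Qed.
Lemma gmod_scaleDr : right_distributive gmod_scale +%R.
Proof. by move=> x u v; apply: gterm_actD. Qed.
Lemma gmod_scaleDl v : {morph gmod_scale^~ v : x y / x + y}.
Proof.
elim/gclass_ind=> a; elim/gclass_ind=> b.
by rewrite [_ + _]gclassD !gmod_scale_class.
Qed.

HB.instance Definition _ := GRing.Zmodule_isLmodule.Build (gwa s t) gmod
  gmod_scaleA gmod_scale1 gmod_scaleDr gmod_scaleDl.

Lemma gmod_X (v : gmod) : gX s t *: v = repX (v : V).
Proof. exact: gmod_scale_class. Qed.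
Lemma gmod_Y (v : gmod) : gY s t *: v = repY (v : V).
Proof. exact: gmod_scale_class. Qed.
Lemma gmod_C r (v : gmod) : gC s t r *: v = r *: (v : V).
Proof. exact: gmod_scale_class. Qed.

End FromGenerators.

Section Act.
Variables (R : comNzRingType) (s : ring_aut R) (t : R).
Variable M : lmodType (gwa s t).

Definition actX (v : resR M) : resR M := gX s t *: (v : M).
Definition actY (v : resR M) : resR M := gY s t *: (v : M).

Lemma resRE r (v : resR M) : r *: v = gC s t r *: (v : M).
Proof. by []. Qed.

Lemma actXD : {morph actX : u v / u + v}.
Proof. exact: (@scalerDr _ M). Qed.
Lemma actYD : {morph actY : u v / u + v}.
Proof. exact: (@scalerDr _ M). Qed.
Lemma actXZ r v : actX (r *: v) = s r *: actX v.
Proof. by rewrite /actX !resRE !(@scalerA _ M) gXC. Qed.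
Lemma actYZ r v : actY (r *: v) = autV s r *: actY v.
Proof. by rewrite /actY !resRE !(@scalerA _ M) gYC. Qed.
Lemma actYX v : actY (actX v) = t *: v.
Proof. by rewrite /actY /actX !resRE (@scalerA _ M) gYX. Qed.
Lemma actXY v : actX (actY v) = s t *: v.
Proof. by rewrite /actY /actX !resRE (@scalerA _ M) gXY. Qed.

End Act.

Section GwaTensor.
Variables (R : comNzRingType) (s : ring_aut R) (t t' : R).
Variables (M : lmodType (gwa s t)) (M' : lmodType (gwa s t')).

Let T : lmodType R := tens (resR M) (resR M').

Definition tensX : T -> T := tens_lift (fun v v' => pure (actX v) (actX v')).
Definition tensY : T -> T := tens_lift (fun v v' => pure (actY v) (actY v')).

Lemma tensX_pure v v' : tensX (pure v v') = pure (actX v) (actX v').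
Proof.
apply: (tens_lift_pure (f := fun v v' => pure (actX v) (actX v'))).
- by move=> m1 m2 n; rewrite actXD pureDl.
- by move=> m n1 n2; rewrite actXD pureDr.
- by move=> r m n; rewrite !actXZ pure_balanced.
Qed.
Lemma tensY_pure v v' : tensY (pure v v') = pure (actY v) (actY v').
Proof.
apply: (tens_lift_pure (f := fun v v' => pure (actY v) (actY v'))).
- by move=> m1 m2 n; rewrite actYD pureDl.
- by move=> m n1 n2; rewrite actYD pureDr.
- by move=> r m n; rewrite !actYZ pure_balanced.
Qed.
Lemma tensXD : {morph tensX : x y / x + y}.
Proof.
apply: tens_liftD.
- by move=> m1 m2 n; rewrite actXD pureDl.
- by move=> m n1 n2; rewrite actXD pureDr.
- by move=> r m n; rewrite !actXZ pure_balanced.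
Qed.
Lemma tensYD : {morph tensY : x y / x + y}.
Proof.
apply: tens_liftD.
- by move=> m1 m2 n; rewrite actYD pureDl.
- by move=> m n1 n2; rewrite actYD pureDr.
- by move=> r m n; rewrite !actYZ pure_balanced.
Qed.

Lemma tensXZ r x : tensX (r *: x) = s r *: tensX x.
Proof.
move: x; apply: (tens_ext (g := fun x => tensX (r *: x))
                          (h := fun x => s r *: tensX x)).
- by move=> x y /=; rewrite scalerDr tensXD.
- by move=> x y /=; rewrite tensXD scalerDr.
- by move=> v v' /=; rewrite pureZ !tensX_pure pureZ actXZ.
Qed.
Lemma tensYZ r x : tensY (r *: x) = autV s r *: tensY x.
Proof.
move: x; apply: (tens_ext (g := fun x => tensY (r *: x))
                          (h := fun x => autV s r *: tensY x)).
- by move=> x y /=; rewrite scalerDr tensYD.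
- by move=> x y /=; rewrite tensYD scalerDr.
- by move=> v v' /=; rewrite pureZ !tensY_pure pureZ actYZ.
Qed.
Lemma tensYX x : tensY (tensX x) = (t * t') *: x.
Proof.
move: x; apply: (tens_ext (g := fun x => tensY (tensX x))
                          (h := fun x => (t * t') *: x)).
- by move=> x y /=; rewrite tensXD tensYD.
- by move=> x y /=; rewrite scalerDr.
move=> v v' /=; rewrite tensX_pure tensY_pure !actYX.
by rewrite -pure_balanced scalerA pureZ mulrC.
Qed.
Lemma tensXY x : tensX (tensY x) = s (t * t') *: x.
Proof.
move: x; apply: (tens_ext (g := fun x => tensX (tensY x))
                          (h := fun x => s (t * t') *: x)).
- by move=> x y /=; rewrite tensYD tensXD.
- by move=> x y /=; rewrite scalerDr.
move=> v v' /=; rewrite tensY_pure tensX_pure !actXY.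
by rewrite -pure_balanced scalerA pureZ -rmorphM mulrC.
Qed.

Definition gtens_rep : gwa_rep s (t * t') :=
  GwaRep tensXD tensYD tensXZ tensYZ tensYX tensXY.

Definition gtens : Type := gmod gtens_rep.
HB.instance Definition _ := GRing.Lmodule.on gtens.

End GwaTensor.

Section Weight.
Variables (R : comNzRingType) (m : idealr R) (V : lmodType R).

Definition wspace (v : V) : Prop := forall r, r \in m -> r *: v = 0.

(* dim_{R/m} V_m = c, that is, V_m has a basis of c vectors over R/m. A scalar
   in R/m acts on V_m through any of its representatives in R. *)
Definition wdim (c : nat) : Prop :=
  exists2 b : 'I_c -> V, forall j, wspace (b j)
    & forall v, wspace v ->
        exists! a : {ffun 'I_c -> {ideal_quot m}},
          v = \sum_(j < c) repr (a j) *: b j.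

End Weight.

Inductive letter := L1 | Lx | Ly | L0.

Definition letter_mul (a b : letter) : letter :=
  match a, b with
  | L1, c | c, L1 => c
  | Lx, Lx => Lx
  | Ly, Ly => Ly
  | _, _ => L0
  end.

(* The letter w_k of the word w = w_b w_{b+1} ... whose first index is b. *)
Definition letter_at (b : nat) (w : seq letter) (k : nat) : letter :=
  nth L0 w (k - b).

Section Words.
Variables (R : comNzRingType) (s : ring_aut R) (p : nat) (m0 : idealr R) (t : R).

(* The word w, indexed from b, belongs to D^t_omega. *)
Definition in_D (b : nat) (w : seq letter) : Prop :=
  forall k, (b <= k < b + size w)%N ->
    letter_at b w k = L1 <-> ~ breaks s m0 p t (orb s m0 k).

(* V^t(omega, i, w) is defined for w = w_{i+1} ... w_{i+l}. *)
Record string_ok (i : nat) (w : seq letter) : Prop := StringOk {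
  string_lt : (i < p)%N;
  string_start : breaks s m0 p t (orb s m0 i);
  string_word : in_D i.+1 w;
  string_stop : breaks s m0 p t (orb s m0 (i + size w).+1) }.

End Words.

Section StringModule.
Variables (R : comNzRingType) (s : ring_aut R) (p : nat) (m0 : idealr R) (t : R).
Variables (i : nat) (w : seq letter).

(* The component at position k : 'I_(l+1) is that of e_{i+1+k}. *)
Definition string_comp (k : 'I_(size w).+1) : lmodType R :=
  {ideal_quot orb s m0 (i.+1 + k)}.

Definition string_space : lmodType R := dsum string_comp.

(* [base_vec k] is e_{i+1+k}, and is 0 for k > l. *)
Definition base_vec (k : nat) : string_space :=
  fun l => \pi_{ideal_quot orb s m0 (i.+1 + l)} (val l == k)%:R.

Notation w_ k := (letter_at i.+1 w k).

(* X e_k = Xcoef k * e_{k+1} and Y e_{k+1} = Ycoef k * e_k whenever e_k and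
   e_{k+1} both belong to the basis; see [stringX_base] and [stringY_base]. *)
Definition Xcoef (k : nat) : R :=
  match w_ k with L1 => s t | Lx => 1 | Ly | L0 => 0 end.
Definition Ycoef (k : nat) : R :=
  match w_ k with L1 | Ly => 1 | Lx | L0 => 0 end.

(* A representative in R of the coordinate of v along e_{i+1+k}. *)
Definition coord_repr (v : string_space) (k : nat) : R :=
  repr (v (inord k) : {ideal_quot orb s m0 (i.+1 + (inord k : 'I_(size w).+1))}).

(* As X and Y are semilinear, the coordinate of X v along e_{k+1} is
   Xcoef k * sigma(v_k), that of Y v along e_k is
   Ycoef k * sigma^{-1}(v_{k+1}), with sigma and its inverse computed on
   representatives of the residue classes. *)
Definition stringX (v : string_space) : string_space := fun l =>
  if val l is k.+1 then
    \pi_{ideal_quot orb s m0 (i.+1 + l)} (Xcoef (i.+1 + k) * s (coord_repr v k))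
  else 0.
Definition stringY (v : string_space) : string_space := fun l =>
  if (l < size w)%N then
    \pi_{ideal_quot orb s m0 (i.+1 + l)}
      (Ycoef (i.+1 + l) * autV s (coord_repr v l.+1))
  else 0.

Definition cong (k : nat) (x y : R) : Prop := x - y \in orb s m0 (i.+1 + k).

Lemma quotP k x y :
  (\pi_{ideal_quot orb s m0 (i.+1 + k)} x = \pi y) <-> cong k x y.
Proof. exact: quot_eq. Qed.

Lemma cong_refl k x : cong k x x.
Proof. by rewrite /cong subrr rpred0. Qed.
Lemma cong_sym k x y : cong k x y -> cong k y x.
Proof. by rewrite /cong -opprB rpredN. Qed.
Lemma cong_trans k x y z : cong k x y -> cong k y z -> cong k x z.
Proof. by rewrite /cong => xy yz; rewrite -(subrK y x) -addrA rpredD. Qed.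
Lemma congD k x y x' y' : cong k x y -> cong k x' y' -> cong k (x + x') (y + y').
Proof. by rewrite /cong opprD addrACA => *; rewrite rpredD. Qed.
Lemma congM k a x y : cong k x y -> cong k (a * x) (a * y).
Proof. by rewrite /cong -mulrBr => H; apply: idealMr. Qed.
Lemma cong_aut k x y : cong k x y -> cong k.+1 (s x) (s y).
Proof. by rewrite /cong -rmorphB addnS mem_orb_aut. Qed.
Lemma cong_autV k x y : cong k.+1 x y -> cong k (autV s x) (autV s y).
Proof. by rewrite /cong -rmorphB addnS mem_orbS. Qed.
Lemma cong_mem k a x y :
  a \in orb s m0 (i.+1 + k) -> cong k x 0 -> cong k x (a * y).
Proof.
move=> am; rewrite /cong subr0 => xm.
by rewrite rpredB // mulrC; apply: idealMr.
Qed.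

Lemma coord_reprE (v : string_space) k (kl : (k < (size w).+1)%N) :
  coord_repr v k = repr (v (Ordinal kl) : {ideal_quot orb s m0 (i.+1 + k)}).
Proof.
rewrite /coord_repr; have -> // : inord k = Ordinal kl.
by apply: val_inj; rewrite /= inordK.
Qed.

Lemma coord_reprK (v : string_space) k (kl : (k < (size w).+1)%N) :
  v (Ordinal kl) = \pi_{ideal_quot orb s m0 (i.+1 + k)} (coord_repr v k).
Proof. by rewrite (coord_reprE v kl) reprK. Qed.

Lemma coord_reprP (v : string_space) k (kl : (k < (size w).+1)%N) x :
    v (Ordinal kl) = \pi_{ideal_quot orb s m0 (i.+1 + k)} x ->
  cong k (coord_repr v k) x.
Proof. by rewrite coord_reprK => /quotP. Qed.

Lemma string_ext (u v : string_space) :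
    (forall k, (k < (size w).+1)%N -> cong k (coord_repr u k) (coord_repr v k)) ->
  u = v.
Proof.
by move=> uv; apply: dsumP => -[k kl]; rewrite !coord_reprK; apply/quotP/uv.
Qed.

Lemma coord_reprD u v k : (k < (size w).+1)%N ->
  cong k (coord_repr (u + v) k) (coord_repr u k + coord_repr v k).
Proof.
move=> kl; apply: (@coord_reprP (u + v) k kl).
rewrite rmorphD; exact: (congr2 (@GRing.add {ideal_quot orb s m0 (i.+1 + k)})
  (coord_reprK u kl) (coord_reprK v kl)).
Qed.

Lemma coord_reprZ r v k : (k < (size w).+1)%N ->
  cong k (coord_repr (r *: v) k) (r * coord_repr v k).
Proof.
move=> kl; apply: (@coord_reprP (r *: v) k kl).
rewrite rmorphM; exact: (congr1 (@GRing.scale _ (string_comp (Ordinal kl)) r)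
  (coord_reprK v kl)).
Qed.

Lemma coord_X0 v : cong 0 (coord_repr (stringX v) 0) 0.
Proof.
by apply: (@coord_reprP (stringX v) 0 isT); rewrite /stringX /= rmorph0.
Qed.
Lemma coord_XS v k : (k < size w)%N ->
  cong k.+1 (coord_repr (stringX v) k.+1) (Xcoef (i.+1 + k) * s (coord_repr v k)).
Proof. by move=> kl; apply: (@coord_reprP (stringX v) k.+1 kl). Qed.
Lemma coord_Y v k : (k < size w)%N ->
  cong k (coord_repr (stringY v) k)
         (Ycoef (i.+1 + k) * autV s (coord_repr v k.+1)).
Proof.
by move=> kl; apply: (@coord_reprP (stringY v) k (ltnW kl)); rewrite /stringY /= kl.
Qed.
Lemma coord_Ylast v : cong (size w) (coord_repr (stringY v) (size w)) 0.
Proof.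
apply: (@coord_reprP (stringY v) (size w) (ltnSn _)).
by rewrite /stringY /= ltnn rmorph0.
Qed.

Lemma stringXD : {morph stringX : u v / u + v}.
Proof.
move=> u v; apply: string_ext => -[|k] kl.
  apply: cong_trans (coord_X0 _) _; apply: cong_sym.
  apply: cong_trans (coord_reprD _ _ kl) _.
  by rewrite -[X in cong _ _ X]addr0; apply: congD; apply: coord_X0.
apply: cong_trans (coord_XS _ kl) _; apply: cong_sym.
apply: cong_trans (coord_reprD _ _ kl) _.
apply: cong_trans (congD (coord_XS _ kl) (coord_XS _ kl)) _.
rewrite -mulrDr -rmorphD; apply/congM/cong_aut/cong_sym/coord_reprD.
exact: ltnW.
Qed.

Lemma stringYD : {morph stringY : u v / u + v}.
Proof.
move=> u v; apply: string_ext => k kl.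
have [kw|wk] := ltnP k (size w); last first.
  have -> : k = size w by apply/eqP; rewrite eqn_leq wk andbT.
  apply: cong_trans (coord_Ylast _) _; apply: cong_sym.
  apply: cong_trans (coord_reprD _ _ (ltnSn _)) _.
  by rewrite -[X in cong _ _ X]addr0; apply: congD; apply: coord_Ylast.
apply: cong_trans (coord_Y _ kw) _; apply: cong_sym.
apply: cong_trans (coord_reprD _ _ kl) _.
apply: cong_trans (congD (coord_Y _ kw) (coord_Y _ kw)) _.
by rewrite -mulrDr -rmorphD; apply/congM/cong_autV/cong_sym/coord_reprD.
Qed.

Lemma stringXZ r v : stringX (r *: v) = s r *: stringX v.
Proof.
apply: string_ext => -[|k] kl; apply: cong_sym;
  apply: cong_trans (coord_reprZ _ _ kl) _.
  apply: cong_sym; apply: cong_trans (coord_X0 _) _; apply: cong_sym.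
  by rewrite -[X in cong _ _ X](mulr0 (s r)); apply/congM/coord_X0.
apply: cong_sym; apply: cong_trans (coord_XS _ kl) _.
apply: cong_trans (congM _ (cong_aut (coord_reprZ _ _ (ltnW kl)))) _.
rewrite rmorphM mulrCA; apply/congM/cong_sym/coord_XS/kl.
Qed.

Lemma stringYZ r v : stringY (r *: v) = autV s r *: stringY v.
Proof.
apply: string_ext => k kl; apply: cong_sym.
apply: cong_trans (coord_reprZ _ _ kl) _.
have [kw|wk] := ltnP k (size w); last first.
  have -> : k = size w by apply/eqP; rewrite eqn_leq wk andbT.
  apply: cong_sym; apply: cong_trans (coord_Ylast _) _; apply: cong_sym.
  by rewrite -[X in cong _ _ X](mulr0 (autV s r)); apply/congM/coord_Ylast.
apply: cong_sym; apply: cong_trans (coord_Y _ kw) _.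
have kw1 : (k.+1 < (size w).+1)%N by [].
apply: cong_trans (congM _ (cong_autV (coord_reprZ _ _ kw1))) _.
by rewrite rmorphM mulrCA; apply/congM/cong_sym/coord_Y.
Qed.

Lemma coord_base k l : (l < (size w).+1)%N ->
  cong l (coord_repr (base_vec k) l) (l == k)%:R.
Proof. by move=> kl; apply: (@coord_reprP (base_vec k) l kl). Qed.

Lemma stringX_base k : (k <= size w)%N ->
  stringX (base_vec k) = Xcoef (i.+1 + k) *: base_vec k.+1.
Proof.
move=> kw; apply: string_ext => -[|l] kl; apply: cong_sym;
  apply: cong_trans (coord_reprZ _ _ kl) _;
  apply: cong_trans (congM _ (coord_base _ kl)) _; apply: cong_sym.
  by rewrite mulr0; apply: coord_X0.
apply: cong_trans (coord_XS _ kl) _.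
apply: cong_trans (congM _ (cong_aut (coord_base _ (ltnW kl)))) _.
rewrite eqSS; case: eqP => [->|_]; rewrite ?rmorph1 ?rmorph0 ?mulr0;
  exact: cong_refl.
Qed.

Lemma stringY_base0 : stringY (base_vec 0) = 0.
Proof.
apply: string_ext => l kl.
have z0 : cong l (coord_repr 0 l) 0.
  by rewrite -[X in cong _ _ X](mul0r (coord_repr 0 l)) -{1}(scale0r 0);
    apply: coord_reprZ.
apply: cong_trans _ (cong_sym z0).
have [lw|wl] := ltnP l (size w); last first.
  have -> : l = size w by apply/eqP; rewrite eqn_leq wl andbT.
  exact: coord_Ylast.
apply: cong_trans (coord_Y _ lw) _.
have lw1 : (l.+1 < (size w).+1)%N by [].
apply: cong_trans (congM _ (cong_autV (coord_base _ lw1))) _.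
by rewrite rmorph0 mulr0; apply: cong_refl.
Qed.

Lemma stringY_base k : (k < size w)%N ->
  stringY (base_vec k.+1) = Ycoef (i.+1 + k) *: base_vec k.
Proof.
move=> kw; apply: string_ext => l kl; apply: cong_sym;
  apply: cong_trans (coord_reprZ _ _ kl) _;
  apply: cong_trans (congM _ (coord_base _ kl)) _; apply: cong_sym.
have [lw|wl] := ltnP l (size w); last first.
  have -> : l = size w by apply/eqP; rewrite eqn_leq wl andbT.
  rewrite gtn_eqF // mulr0; exact: coord_Ylast.
apply: cong_trans (coord_Y _ lw) _.
have lw1 : (l.+1 < (size w).+1)%N by [].
apply: cong_trans (congM _ (cong_autV (coord_base _ lw1))) _.
rewrite eqSS; case: eqP => [->|_]; rewrite ?rmorph1 ?rmorph0 ?mulr0;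
  exact: cong_refl.
Qed.

Hypothesis ok : string_ok s p m0 t i w.

(* X e_k and Y e_{k+1} have coefficients whose product is t modulo
   sigma^k(m_0): both sides vanish unless the letter w_k is 1. *)
Lemma mem_break_letter k : (k < size w)%N ->
  letter_at i.+1 w (i.+1 + k) <> L1 -> t \in orb s m0 (i.+1 + k).
Proof.
move=> kw w1; have [_ _ wD _] := ok.
have /wD wk : (i.+1 <= i.+1 + k < i.+1 + size w)%N.
  by rewrite leq_addr ltn_add2l.
apply/negP=> /negP tm; apply: w1; apply/wk => -[_ tm'].
by rewrite tm' in tm.
Qed.

Lemma coef_YX k x : (k < size w)%N ->
  cong k (Ycoef (i.+1 + k) * autV s (Xcoef (i.+1 + k)) * x) (t * x).
Proof.
move=> kw; rewrite /Xcoef /Ycoef.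
case: letter_at (@mem_break_letter k kw) => [_|tm|tm|tm].
- by rewrite mul1r autK; apply: cong_refl.
- by rewrite !mul0r; apply: cong_mem; [apply: tm | apply: cong_refl].
- by rewrite rmorph0 mulr0 mul0r; apply: cong_mem; [apply: tm | apply: cong_refl].
- by rewrite !mul0r; apply: cong_mem; [apply: tm | apply: cong_refl].
Qed.

Lemma coef_XY k x : (k < size w)%N ->
  cong k.+1 (Xcoef (i.+1 + k) * s (Ycoef (i.+1 + k)) * x) (s t * x).
Proof.
move=> kw; have := cong_aut (@coef_YX k (autV s x) kw).
by rewrite !rmorphM !autVK [_ * s _]mulrC.
Qed.

Lemma stringYX v : stringY (stringX v) = t *: v.
Proof.
apply: string_ext => k kl; apply: cong_sym.
apply: cong_trans (coord_reprZ _ _ kl) _; apply: cong_sym.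
have [kw|wk] := ltnP k (size w); last first.
  have E : k = size w by apply/eqP; rewrite eqn_leq wk andbT.
  rewrite {}E; apply: cong_mem; last exact: coord_Ylast.
  by have [_ _ _ []] := ok; rewrite addSn.
apply: cong_trans (coord_Y _ kw) _.
apply: cong_trans (congM _ (cong_autV (coord_XS _ kw))) _.
by rewrite rmorphM autK mulrA; apply: coef_YX.
Qed.

Lemma stringXY v : stringX (stringY v) = s t *: v.
Proof.
apply: string_ext => -[|k] kl; apply: cong_sym;
  apply: cong_trans (coord_reprZ _ _ kl) _; apply: cong_sym.
  apply: cong_mem; last exact: coord_X0.
  by have [_ [_ tm] _ _] := ok; rewrite addn0 mem_orb_aut.
apply: cong_trans (coord_XS _ kl) _.
apply: cong_trans (congM _ (cong_aut (coord_Y _ kl))) _.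
by rewrite rmorphM autVK mulrA; apply: coef_XY.
Qed.

Definition string_rep : gwa_rep s t :=
  GwaRep stringXD stringYD stringXZ stringYZ stringYX stringXY.

(* The A(t)-module V^t(omega, i, w). *)
Definition string_mod : Type := gmod string_rep.
HB.instance Definition _ := GRing.Lmodule.on string_mod.

End StringModule.

Section ProductWords.
Variables (p i i' : nat) (w w' : seq letter).

(* The truncated subtractions lose nothing: m_j and n_j are nonnegative for all
   the values of j that occur in the decomposition. *)
Definition len_m (j : nat) : nat := minn (i + size w - (i' + j * p)) (size w').
Definition len_n (j : nat) : nat := minn (size w) (i' + size w' - (i + j * p)).

(* (w')^(j), indexed from i'+1. *)
Definition word_w' (j : nat) : seq letter :=
  mkseq (fun k => letter_mul (letter_at i.+1 w (i'.+1 + j * p + k))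
                             (letter_at i'.+1 w' (i'.+1 + k))) (len_m j).

(* w^(j), indexed from i+1. *)
Definition word_w (j : nat) : seq letter :=
  mkseq (fun k => letter_mul (letter_at i.+1 w (i.+1 + k))
                             (letter_at i'.+1 w' (i.+1 + j * p + k))) (len_n j).

End ProductWords.

Definition lmod_iso (S : pzRingType) (M N : lmodType S) : Prop :=
  exists f : {linear M -> N}, bijective f.

(* Main.v *)
(** The summand (R/sigma^k(m_0))e_k (x) (R/sigma^k'(m_0))e'_k' vanishes unless
    k = k' mod p, so V (x) V' has basis the e_k (x) e'_k' with k - k' divisible
    by p. Both X and Y preserve the difference k - k', and each diagonal
    k - k' = jp is a string module up to rescaling its basis by residues that
    are nonzero modulo the respective maximal ideals. Those with j >= 0 start at
    e'_(i'+1), those with j < 0 at e_(i+1), which accounts for the two families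
    of words; their numbers are the two given dimensions. *)

Require Import Defs.
From HB Require Import structures.
From mathcomp Require Import all_boot all_algebra.
From mathcomp Require Import generic_quotient ring_quotient boolp zify.

Set Implicit Arguments.
Unset Strict Implicit.
Unset Printing Implicit Defensive.

Import GRing.Theory.
Local Open Scope ring_scope.
Local Open Scope quotient_scope.

Section Residues.
Variables (R : comNzRingType) (m : idealr R).

Definition residue (x : R) : {ideal_quot m} := \pi x.

Lemma residue_eq x y : residue x = residue y <-> x - y \in m.
Proof. exact: quot_eq. Qed.

Lemma residueK (x : {ideal_quot m}) : residue (repr x) = x.
Proof. exact: reprK. Qed.

Lemma residueD x y : residue (x + y) = residue x + residue y.
Proof. exact: rmorphD. Qed.

Lemma residueM x y : residue (x * y) = residue x * residue y.
Proof. exact: rmorphM. Qed.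

Lemma residue0 : residue 0 = 0.
Proof. exact: rmorph0. Qed.

Lemma residue1 : residue 1 = 1.
Proof. exact: rmorph1. Qed.

Lemma residue_mem x : x \in m -> residue x = 0.
Proof. by move=> xm; rewrite -residue0; apply/residue_eq; rewrite subr0. Qed.

Lemma residue_sum (I : Type) (r : seq I) (P : pred I) (F : I -> R) :
  residue (\sum_(i <- r | P i) F i) = \sum_(i <- r | P i) residue (F i).
Proof. by apply: (big_morph residue residueD residue0). Qed.

End Residues.

Section Ideals.
Variables (R : comNzRingType) (s : ring_aut R).
Implicit Types (m J : idealr R) (r x y : R).

Lemma maximal_inv m r : maximal_ideal m -> r \notin m ->
  exists a, r * a - 1 \in m.
Proof.
move=> m_max rm; apply: contrapT => no_inv.
pose S : {pred R} := [pred x | `[< exists2 y, y \in m & exists a, x = y + r * a >]].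
have S_closed : idealr_closed S.
  split=> [||a x y]; rewrite !inE.
  - by apply/asboolP; exists 0; rewrite ?rpred0 //; exists 0; rewrite mulr0 addr0.
  - apply/asboolPn => -[y ym [a E]]; apply: no_inv; exists a.
    by rewrite E opprD addrCA subrr addr0 rpredN.
  move=> /asboolP[x' x'm [b ->]] /asboolP[y' y'm [c ->]]; apply/asboolP.
  exists (a * x' + y'); first by rewrite rpredD // idealMr.
  by exists (a * b + c); rewrite !mulrDr mulrCA addrACA.
pose J : idealr R :=
  HB.pack_for (idealr R) S (isIdealr.Build R S S_closed).
have E : J =i m.
  apply: m_max => x xm; rewrite inE; apply/asboolP.
  by exists x => //; exists 0; rewrite mulr0 addr0.
move: rm; rewrite -E inE => /asboolP; apply; exists 0; rewrite ?rpred0 //.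
by exists 1; rewrite mulr1 add0r.
Qed.

Lemma maximal_mem_mul m x y : maximal_ideal m ->
  x * y \in m -> y \notin m -> x \in m.
Proof.
move=> m_max xym /(maximal_inv m_max)[a ya].
have -> : x = a * (x * y) - x * (y * a - 1).
  by rewrite mulrBr mulr1 opprB addrCA [a * _]mulrC mulrA subrr addr0.
by apply: rpredB; apply: idealMr.
Qed.

Lemma maximal_coprime m m' : maximal_ideal m -> maximal_ideal m' ->
  ~ m =i m' -> exists2 x, x \in m & 1 - x \in m'.
Proof.
move=> m_max m'_max neq.
have [r rm rm'] : exists2 r, r \in m & r \notin m'.
  apply: contrapT => H; apply: neq => x; rewrite m_max // => {}x xm.
  by apply: contrapT => /negP xm'; apply: H; exists x.
have [a ra] := maximal_inv m'_max rm'.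
by exists (r * a); [rewrite mulrC idealMr | rewrite -opprB rpredN].
Qed.

Lemma aut_img_maximal m : maximal_ideal m ->
  maximal_ideal (aut_img s m : idealr R).
Proof.
move=> m_max J mJ x; rewrite -[in LHS](autVK s x) inE.
pose sV := RingAut (autVK s) (autK s).
rewrite -(m_max (aut_img sV J : idealr R)) ?inE // => y ym.
by rewrite inE; apply: mJ; rewrite inE autK.
Qed.

Lemma orb_maximal m k : maximal_ideal m -> maximal_ideal (orb s m k).
Proof. by move=> m_max; elim: k => //= k; apply: aut_img_maximal. Qed.

Lemma mem_orb m k r : (r \in orb s m k) = (iter k (autV s) r \in m).
Proof. by elim: k r => //= k IH r; rewrite mem_orbS IH -iterSr. Qed.

End Ideals.

Section PeriodicOrbit.
Variables (R : comNzRingType) (s : ring_aut R) (p : nat) (m0 : idealr R).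
Hypothesis s_order : forall r : R, iter p s r = r.

Lemma iter_autV r : iter p (autV s) r = r.
Proof.
have iterK q x : iter q (autV s) (iter q s x) = x.
  by elim: q x => // q IH x; rewrite iterSr iterS autK.
by rewrite -[r in LHS]s_order iterK.
Qed.

Lemma mem_orb_mod k r : (r \in orb s m0 k) = (r \in orb s m0 (k %% p)).
Proof.
have E : iter (k %/ p * p) (autV s) r = r.
  by elim: (k %/ p)%N => // q IH; rewrite mulSn iterD IH iter_autV.
by rewrite !mem_orb {1}(divn_eq k p) addnC iterD E.
Qed.

Lemma mem_orb_eqmod k l r : (k = l %[mod p])%N ->
  (r \in orb s m0 k) = (r \in orb s m0 l).
Proof. by move=> E; rewrite mem_orb_mod E -mem_orb_mod. Qed.

Hypothesis orb_card : forall k l : nat, (k < p)%N -> (l < p)%N ->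
  orb s m0 k =i orb s m0 l -> k = l.
Hypothesis p_gt0 : (0 < p)%N.

Lemma orb_inj_mod k l : orb s m0 k =i orb s m0 l -> (k = l %[mod p])%N.
Proof.
move=> E; apply: orb_card; rewrite ?ltn_pmod // => r.
by rewrite -!mem_orb_mod.
Qed.

Lemma breaks_orb t k : breaks s m0 p t (orb s m0 k) <-> t \in orb s m0 k.
Proof.
split=> [[]//|tk]; split=> //.
by exists (k %% p)%N; [rewrite ltn_pmod | exact: mem_orb_mod].
Qed.

End PeriodicOrbit.

Lemma lmod_iso_linear (S : pzRingType) (M N : lmodType S) (f : M -> N) :
  linear f -> bijective f -> lmod_iso M N.
Proof.
move=> f_lin f_bij.
pose f' : {linear M -> N} :=
  HB.pack_for {linear M -> N} f (GRing.isLinear.Build S M N *:%R f f_lin).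
by exists f'.
Qed.

Lemma lmod_iso_trans (S : pzRingType) (M N P : lmodType S) :
  lmod_iso M N -> lmod_iso N P -> lmod_iso M P.
Proof.
move=> [f f_bij] [g g_bij].
apply: (@lmod_iso_linear _ _ _ (g \o f)); last exact: bij_comp.
by move=> a u v /=; rewrite !linearP.
Qed.

Lemma dsum_sum_iso (S : pzRingType) (I J : finType) (M : I + J -> lmodType S) :
  lmod_iso (dsum M)
    (dsum (fun i => M (inl i)) * dsum (fun j => M (inr j)))%type.
Proof.
pose f (x : dsum M) : dsum (fun i => M (inl i)) * dsum (fun j => M (inr j)) :=
  (fun i => x (inl i), fun j => x (inr j)).
pose g (y : dsum (fun i => M (inl i)) * dsum (fun j => M (inr j))) : dsum M :=
  fun k => match k with inl i => y.1 i | inr j => y.2 j end.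
apply: (@lmod_iso_linear _ _ _ f) => //.
by exists g => [x|[y z] //]; apply: dsumP; case.
Qed.

Lemma gwa_scalable (R : comNzRingType) (s : ring_aut R) (t : R)
    (M N : lmodType (gwa s t)) (f : M -> N) :
    {morph f : u v / u + v} ->
    (forall r v, f (gC s t r *: v) = gC s t r *: f v) ->
    (forall v, f (gX s t *: v) = gX s t *: f v) ->
    (forall v, f (gY s t *: v) = gY s t *: f v) ->
  scalable f.
Proof.
move=> fD fC fX fY; elim/gclass_ind.
have fN v : f (- v) = - f v.
  have f0 : f 0 = 0 by apply: (addrI (f 0)); rewrite -fD !addr0.
  by apply: (addrI (f v)); rewrite -fD !subrr.
elim=> [r|||a IH|a IHa b IHb|a IHa b IHb] v; [exact: fC|exact: fX|exact: fY|..].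
- by rewrite -[gclass s t (GOpp a)]gclassN !scaleNr fN IH.
- by rewrite -[gclass s t (GAdd a b)]gclassD !scalerDl fD IHa IHb.
- by rewrite -[gclass s t (GMul a b)]gclassM -!scalerA IHa IHb.
Qed.

Section WeightDimension.
Variables (R : comNzRingType) (m : idealr R) (V : lmodType R).
Implicit Types (x y : {ideal_quot m}) (v : V).

Lemma wspaceZ_eq v r r' : wspace m v ->
  residue m r = residue m r' -> r *: v = r' *: v.
Proof.
move=> vm /residue_eq rm; apply/eqP; rewrite -subr_eq0 -scalerBl; apply/eqP.
exact: vm.
Qed.

Lemma wdim_leq c n : wdim m V c -> wdim m V n -> (c <= n)%N.
Proof.
move=> [b bm b_basis] [d dm d_basis].
have /choice[A bA] j : exists a : {ffun 'I_n -> {ideal_quot m}},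
    b j = \sum_(k < n) repr (a k) *: d k.
  by have [a [Ea _]] := d_basis _ (bm j); exists a.
have /choice[B dB] k : exists a : {ffun 'I_c -> {ideal_quot m}},
    d k = \sum_(j < c) repr (a j) *: b j.
  by have [a [Ea _]] := b_basis _ (dm k); exists a.
apply: (@mulmx1_min _ _ _ (\matrix_(j, k) A j k) (\matrix_(k, j) B k j)).
apply/matrixP=> j j'; rewrite !mxE.
have [a [_ a_uniq]] := b_basis _ (bm j).
have E1 : a = [ffun l => \sum_k A j k * B k l].
  apply: a_uniq.
  rewrite [LHS]bA; under eq_bigr do rewrite dB scaler_sumr.
  rewrite exchange_big; apply: eq_bigr => l _; rewrite ffunE.
  under eq_bigr do rewrite scalerA.
  rewrite -scaler_suml; apply: (wspaceZ_eq (bm l)).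
  rewrite residueK residue_sum; apply: eq_bigr => k _.
  by rewrite residueM !residueK.
have E2 : a = [ffun l => (j == l)%:R].
  apply: a_uniq; rewrite (bigD1 j) //= big1 => [|l /negPf jl]; rewrite ffunE.
    rewrite eqxx addr0 -[LHS]scale1r; apply: (wspaceZ_eq (bm j)).
    by rewrite residueK residue1.
  rewrite eq_sym jl -(scale0r (b l)); apply: (wspaceZ_eq (bm l)).
  by rewrite residueK residue0.
have /ffunP/(_ j') : [ffun l => (j == l)%:R] = [ffun l => \sum_k A j k * B k l].
  by rewrite -E1 -E2.
by rewrite !ffunE => ->; apply: eq_bigr => k _; rewrite !mxE.
Qed.

Lemma wdim_unique c n : wdim m V c -> wdim m V n -> c = n.
Proof. by move=> Hc Hn; apply/eqP; rewrite eqn_leq !wdim_leq. Qed.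

End WeightDimension.

Lemma wdim_iso (R : comNzRingType) (m : idealr R) (U V : lmodType R) n :
  lmod_iso U V -> wdim m U n -> wdim m V n.
Proof.
move=> [f f_bij] [b bm b_basis]; have [g fK gK] := f_bij.
have f_inj := can_inj fK.
have f_sum (a : {ffun 'I_n -> {ideal_quot m}}) :
    f (\sum_(j < n) repr (a j) *: b j) = \sum_(j < n) repr (a j) *: f (b j).
  by rewrite linear_sum; apply: eq_bigr => j _; rewrite linearZ.
exists (f \o b) => [j r rm|v vm]; first by rewrite /= -linearZ bm // linear0.
have [|a [Ea a_uniq]] := b_basis (g v).
  by move=> r rm; apply: f_inj; rewrite linearZ /= gK vm // linear0.
exists a; split=> [|a' Ea']; first by rewrite -f_sum -Ea gK.
by apply: a_uniq; apply: f_inj; rewrite gK f_sum.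
Qed.

Section Coordinates.
Variables (R : comNzRingType) (s : ring_aut R) (p : nat) (m0 : idealr R).
Hypothesis s_order : forall r : R, iter p s r = r.
Variables (i : nat) (w : seq letter).
Implicit Types (u v : string_space s m0 i w) (K k : nat).

(* The ideals sigma^k(m_0) are indexed by all naturals, so that two of them may
   be equal without being convertible; the target index K is therefore a free
   representative of i + 1 + k modulo p. *)
Definition rcoord K v k : {ideal_quot orb s m0 K} :=
  residue (orb s m0 K) (coord_repr v k).

Lemma residue_cong K k x y : (i.+1 + k = K %[mod p])%N -> cong s m0 i k x y ->
  residue (orb s m0 K) x = residue (orb s m0 K) y.
Proof.
by move=> E xy; apply/residue_eq; rewrite -(mem_orb_eqmod m0 s_order _ E).
Qed.

Definition string_of (x : nat -> R) : string_space s m0 i w :=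
  fun l => residue (orb s m0 (i.+1 + l)) (x l).

Lemma coord_repr_string_of x k : (k <= size w)%N ->
  cong s m0 i k (coord_repr (string_of x) k) (x k).
Proof. by move=> kw; apply: (@coord_reprP _ _ _ _ _ _ _ kw). Qed.

Section At.
Variables (K k : nat).
Hypotheses (EK : (i.+1 + k = K %[mod p])%N) (kw : (k <= size w)%N).

Lemma rcoord_string_of x : rcoord K (string_of x) k = residue _ (x k).
Proof. exact/(residue_cong EK)/coord_repr_string_of. Qed.

Lemma rcoordD u v : rcoord K (u + v) k = rcoord K u k + rcoord K v k.
Proof. by rewrite -residueD; apply/(residue_cong EK)/coord_reprD. Qed.

Lemma rcoordZ r v : rcoord K (r *: v) k = residue _ r * rcoord K v k.
Proof. by rewrite -residueM; apply/(residue_cong EK)/coord_reprZ. Qed.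

Lemma rcoord0 : rcoord K 0 k = 0.
Proof. by rewrite -(scale0r 0) rcoordZ residue0 mul0r. Qed.

Lemma rcoord_sum (I : Type) (r : seq I) (P : pred I) F :
  rcoord K (\sum_(j <- r | P j) F j) k = \sum_(j <- r | P j) rcoord K (F j) k.
Proof. by apply: (big_morph (fun v => rcoord K v k) rcoordD rcoord0). Qed.

Lemma rcoord_base_vec l : rcoord K (base_vec s m0 i l) k = (k == l)%:R.
Proof.
rewrite /rcoord (residue_cong EK (coord_base _ _ _ _ kw)).
by case: eqP => _; rewrite ?residue0 ?residue1.
Qed.

End At.

Lemma rcoord_ext u v :
    (forall k, (k <= size w)%N -> rcoord (i.+1 + k) u k = rcoord (i.+1 + k) v k) ->
  u = v.
Proof. by move=> uv; apply: string_ext => k kw; apply/residue_eq/uv. Qed.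

Lemma string_expansion v :
  v = \sum_(k < (size w).+1) coord_repr v k *: base_vec s m0 i k.
Proof.
apply: rcoord_ext => k kw.
rewrite rcoord_sum // (bigD1 (Ordinal (kw : (k < _.+1)%N))) //=.
rewrite big1 => [|l lk]; rewrite rcoordZ // rcoord_base_vec //.
  by rewrite eqxx mulr1 addr0.
by rewrite -(inj_eq val_inj) eq_sym in lk; rewrite (negPf lk) mulr0.
Qed.

Lemma base_vec_killed k r : r \in orb s m0 (i.+1 + k) ->
  r *: (base_vec s m0 i k : string_space s m0 i w) = 0.
Proof.
move=> rk; apply: rcoord_ext => l lw.
rewrite rcoordZ // rcoord_base_vec // rcoord0 //.
by case: eqP => [->|_]; rewrite ?mulr0 // mulr1 residue_mem.
Qed.

Section Generators.
Variables (t : R) (K : nat).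

Lemma rcoord_stringX0 v : (i.+1 = K %[mod p])%N -> rcoord K (stringX t v) 0 = 0.
Proof.
rewrite -{1}(addn0 i.+1) -(residue0 (orb s m0 K)) => EK.
exact/(residue_cong EK)/coord_X0.
Qed.

Lemma rcoord_stringXS v k :
    (i.+1 + k.+1 = K %[mod p])%N -> (k < size w)%N ->
  rcoord K (stringX t v) k.+1
  = residue _ (Xcoef s t i w (i.+1 + k) * s (coord_repr v k)).
Proof. by move=> EK kw; apply/(residue_cong EK)/coord_XS. Qed.

Lemma rcoord_stringY v k :
    (i.+1 + k = K %[mod p])%N -> (k < size w)%N ->
  rcoord K (stringY v) k
  = residue _ (Ycoef R i w (i.+1 + k) * autV s (coord_repr v k.+1)).
Proof. by move=> EK kw; apply/(residue_cong EK)/coord_Y. Qed.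

Lemma rcoord_stringY_last v :
  (i.+1 + size w = K %[mod p])%N -> rcoord K (stringY v) (size w) = 0.
Proof.
rewrite -(residue0 (orb s m0 K)) => EK.
exact/(residue_cong EK)/coord_Ylast.
Qed.

End Generators.

Hypothesis m0_max : maximal_ideal m0.
Hypothesis orb_card : forall k l : nat, (k < p)%N -> (l < p)%N ->
  orb s m0 k =i orb s m0 l -> k = l.
Hypothesis p_gt0 : (0 < p)%N.

Lemma string_space_wdim K a n : (i.+1 + a = K %[mod p])%N -> (a < p)%N ->
    (forall j, (j < n)%N = (a + j * p <= size w)%N) ->
  wdim (orb s m0 K) (string_space s m0 i w) n.
Proof.
move=> EK lt_ap nE.
have EKj j : (i.+1 + (a + j * p) = K %[mod p])%N.
  by rewrite addnA addnC modnMDl.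
exists (fun j => base_vec s m0 i (a + j * p)) => [j r rK|v vK].
  by apply: base_vec_killed; rewrite (mem_orb_eqmod m0 s_order _ (EKj j)).
have coord_comb (x : {ffun 'I_n -> {ideal_quot orb s m0 K}}) (j : 'I_n) :
    rcoord K (\sum_(j < n) repr (x j) *: base_vec s m0 i (a + j * p)) (a + j * p)
    = x j.
  have jw : (a + j * p <= size w)%N by rewrite -nE.
  rewrite (rcoord_sum (EKj j)) // (bigD1 j) //= big1 => [|l lj].
    by rewrite (rcoordZ (EKj j)) // rcoord_base_vec // eqxx mulr1 addr0 residueK.
  rewrite (rcoordZ (EKj j)) // rcoord_base_vec //.
  by rewrite eqn_add2l eqn_pmul2r // eq_sym (inj_eq val_inj) (negPf lj) mulr0.
exists [ffun j : 'I_n => rcoord K v (a + j * p)]; split; last first.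
  by move=> x ->; apply/ffunP => j; rewrite ffunE coord_comb.
apply: rcoord_ext => k kw.
have [/eqP Ek|Ek] := boolP (i.+1 + k == K %[mod p])%N.
  have /eqP : (k = a %[mod p])%N.
    by apply/eqP; rewrite -(eqn_modDl i.+1) Ek EK.
  rewrite (modn_small lt_ap) => /eqP ka.
  have jn : (k %/ p < n)%N by rewrite nE -{1}ka addnC -divn_eq.
  have kE : k = (a + Ordinal jn * p)%N by rewrite /= -{1}ka addnC -divn_eq.
  apply/residue_eq; rewrite (mem_orb_eqmod m0 s_order _ Ek); apply/residue_eq.
  have := coord_comb [ffun j : 'I_n => rcoord K v (a + j * p)] (Ordinal jn).
  by rewrite ffunE -kE => /esym.
have vk r : r \in orb s m0 K ->
    residue (orb s m0 (i.+1 + k)) r * rcoord (i.+1 + k) v k = 0.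
  by move=> rK; rewrite -rcoordZ // vK // rcoord0.
have [r rK rk] : exists2 r, r \in orb s m0 K & 1 - r \in orb s m0 (i.+1 + k).
  apply: maximal_coprime; try exact: orb_maximal.
  by move=> /(orb_inj_mod s_order orb_card p_gt0) E; rewrite E eqxx in Ek.
have r1 : residue (orb s m0 (i.+1 + k)) r = 1.
  by apply/esym; rewrite -residue1; apply/residue_eq.
rewrite -[LHS]mul1r -r1 vk // rcoord_sum // big1 // => j _.
rewrite rcoordZ // rcoord_base_vec //; case: eqP => [E|_]; rewrite ?mulr0 //.
by rewrite E EKj eqxx in Ek.
Qed.

End Coordinates.

Section StringResR.
Variables (R : comNzRingType) (s : ring_aut R) (p : nat) (m0 : idealr R) (t : R).
Variables (i : nat) (w : seq letter) (ok : string_ok s p m0 t i w).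

Lemma resR_stringZ r (v : resR (string_mod ok)) :
  r *: v = r *: (v : string_space s m0 i w).
Proof. exact: gmod_C. Qed.

Lemma resR_string_iso : lmod_iso (string_space s m0 i w) (resR (string_mod ok)).
Proof.
apply: (@lmod_iso_linear _ _ _ (id : string_space s m0 i w -> resR (string_mod ok))).
  by move=> r u v; rewrite resR_stringZ.
by exists id.
Qed.

End StringResR.

Section Diagonal.
Variables (R : comNzRingType) (s : ring_aut R) (p : nat) (m0 : idealr R).
Variables (t t' : R) (i i' : nat) (w w' : seq letter).
Hypothesis s_order : forall r : R, iter p s r = r.
Hypothesis m0_max : maximal_ideal m0.
Variables (okV : string_ok s p m0 t i w) (okV' : string_ok s p m0 t' i' w').

Let p_gt0 : (0 < p)%N.
Proof. exact: leq_ltn_trans (string_lt okV). Qed.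

Lemma letter_at_add n (v : seq letter) k : letter_at n v (n + k) = nth L0 v k.
Proof. by rewrite /letter_at addKn. Qed.

Lemma string_letterP (r : R) n (v : seq letter) (ok : string_ok s p m0 r n v) k :
  (k < size v)%N -> nth L0 v k = L1 <-> r \notin orb s m0 (n.+1 + k).
Proof.
move=> kv; rewrite -(letter_at_add n.+1).
have -> := string_word ok (k := n.+1 + k); last by rewrite leq_addr ltn_add2l.
rewrite breaks_orb //; split=> /negP //.
Qed.

(* The vectors e_{i+1+a+l} (x) e'_{i'+1+b+l} with l <= size W span a maximal
   X, Y-stable diagonal of V (x) V'; it is a string of type (I, W). *)
Record diagonal (I : nat) (W : seq letter) (a b : nat) : Prop := Diagonal {
  diag_lt : (I < p)%N;
  diag_left : (i + a = I %[mod p])%N;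
  diag_right : (i' + b = I %[mod p])%N;
  diag_left_size : (a + size W <= size w)%N;
  diag_right_size : (b + size W <= size w')%N;
  diag_start : a = 0%N \/ b = 0%N;
  diag_stop : (a + size W = size w)%N \/ (b + size W = size w')%N;
  diag_letter : forall l, (l < size W)%N ->
    nth L0 W l = letter_mul (nth L0 w (a + l)) (nth L0 w' (b + l)) }.

Variables (I : nat) (W : seq letter) (a b : nat) (D : diagonal I W a b).

Lemma diag_left_mod l : (i.+1 + (a + l) = I.+1 + l %[mod p])%N.
Proof.
by apply/eqP; rewrite !addSnnS -addnS addnA eqn_modDr (diag_left D).
Qed.

Lemma diag_right_mod l : (i'.+1 + (b + l) = I.+1 + l %[mod p])%N.
Proof.
by apply/eqP; rewrite !addSnnS -addnS addnA eqn_modDr (diag_right D).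
Qed.

Lemma diag_left_leq l : (l <= size W)%N -> (a + l <= size w)%N.
Proof. by move=> lW; apply: leq_trans (diag_left_size D); rewrite leq_add2l. Qed.

Lemma diag_right_leq l : (l <= size W)%N -> (b + l <= size w')%N.
Proof. by move=> lW; apply: leq_trans (diag_right_size D); rewrite leq_add2l. Qed.

Lemma diag_left_ltn l : (l < size W)%N -> (a + l < size w)%N.
Proof. by rewrite -addnS; apply: diag_left_leq. Qed.

Lemma diag_right_ltn l : (l < size W)%N -> (b + l < size w')%N.
Proof. by rewrite -addnS; apply: diag_right_leq. Qed.

Lemma diag_left_letter l : (l < size W)%N ->
  nth L0 w (a + l) = L1 <-> t \notin orb s m0 (I.+1 + l).
Proof.
move=> /diag_left_ltn/(string_letterP okV) ->.
by rewrite (mem_orb_eqmod m0 s_order _ (diag_left_mod l)).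
Qed.

Lemma diag_right_letter l : (l < size W)%N ->
  nth L0 w' (b + l) = L1 <-> t' \notin orb s m0 (I.+1 + l).
Proof.
move=> /diag_right_ltn/(string_letterP okV') ->.
by rewrite (mem_orb_eqmod m0 s_order _ (diag_right_mod l)).
Qed.

Lemma diag_ok : string_ok s p m0 (t * t') I W.
Proof.
split; first exact: (diag_lt D).
- apply/breaks_orb => //; case: (diag_start D) => E.
    rewrite mulrC; apply: idealMr.
    rewrite -(mem_orb_eqmod m0 s_order _ (diag_left D)) E addn0.
    by have [] := string_start okV.
  apply: idealMr.
  rewrite -(mem_orb_eqmod m0 s_order _ (diag_right D)) E addn0.
  by have [] := string_start okV'.
- move=> k /andP[Ik kW]; rewrite breaks_orb // -(subnKC Ik).
  rewrite -(subnKC Ik) ltn_add2l in kW; set l := (k - I.+1)%N in kW *.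
  rewrite letter_at_add (diag_letter D kW).
  have [leftP rightP] := (diag_left_letter kW, diag_right_letter kW).
  split=> [|tt'].
    case: (nth _ w _) leftP (nth _ w' _) rightP => [] [tl _] [] [tr _] // _.
    move=> /(maximal_mem_mul (orb_maximal m0_max))/(_ (tr erefl)).
    exact/negP/tl.
  suff [-> ->] : nth L0 w (a + l) = L1 /\ nth L0 w' (b + l) = L1 by [].
  split; [apply/leftP|apply/rightP]; apply/negP => tm; apply: tt'.
    by rewrite mulrC; apply: idealMr.
  exact: idealMr.
apply/breaks_orb => //; case: (diag_stop D) => E.
  rewrite mulrC; apply: idealMr.
  rewrite -addSn -(mem_orb_eqmod m0 s_order _ (diag_left_mod _)).
  rewrite E addSn.
  by have [] := string_stop okV.
apply: idealMr.
rewrite -addSn -(mem_orb_eqmod m0 s_order _ (diag_right_mod _)) E addSn.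
by have [] := string_stop okV'.
Qed.

(* For the letters (1, x) the product of the coefficients of X is sigma(t),
   whereas the coefficient is 1 for the product letter x; the discrepancy is
   absorbed by rescaling the basis of the diagonal. The scale is built from the
   last vector backwards, which avoids inverting t and t'. *)
Definition diag_ratio (l : nat) : R :=
  match nth L0 w (a + l), nth L0 w' (b + l) with
  | L1, Lx => t
  | Lx, L1 => t'
  | _, _ => 1
  end.

Definition diag_scale (l : nat) : R :=
  foldr (fun x y => x * autV s y) 1 (drop l (mkseq diag_ratio (size W))).

Lemma diag_scaleS l : (l < size W)%N ->
  diag_scale l = diag_ratio l * autV s (diag_scale l.+1).
Proof.
by move=> lW; rewrite /diag_scale (drop_nth 0) ?size_mkseq //= nth_mkseq.
Qed.

Lemma diag_ratio_notin l : (l < size W)%N ->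
  diag_ratio l \notin orb s m0 (I.+1 + l).
Proof.
move=> lW; rewrite /diag_ratio.
case: (nth _ w _) (diag_left_letter lW) (nth _ w' _) (diag_right_letter lW)
  => [] [tl _] [] [tr _]; rewrite ?idealr1 //.
- exact: tl.
- exact: tr.
Qed.

Lemma diag_scale_notin l : (l <= size W)%N ->
  diag_scale l \notin orb s m0 (I.+1 + l).
Proof.
move=> lW; rewrite -(subKn lW).
elim: (size W - l)%N (leq_subr l (size W)) => [|n IH] nW.
  by rewrite subn0 /diag_scale drop_oversize ?size_mkseq //= idealr1.
have lW' : (size W - n.+1 < size W)%N by lia.
rewrite diag_scaleS //; apply/negP => /(maximal_mem_mul (orb_maximal m0_max)).
have -> : ((size W - n.+1).+1 = size W - n)%N by lia.
move=> H; move/negP: (diag_ratio_notin lW'); apply; apply: H.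
rewrite -mem_orbS -addnS.
have -> : ((size W - n.+1).+1 = size W - n)%N by lia.
exact/IH/ltnW.
Qed.

Lemma diag_Xcoef l : (l < size W)%N ->
  Xcoef s (t * t') I W (I.+1 + l) * s (diag_scale l)
  = diag_scale l.+1 *
    (Xcoef s t i w (i.+1 + (a + l)) * Xcoef s t' i' w' (i'.+1 + (b + l))).
Proof.
move=> lW; rewrite (diag_scaleS lW) rmorphM autVK mulrA mulrC; congr (_ * _).
rewrite /Xcoef !letter_at_add (diag_letter D lW) /diag_ratio.
case: (nth _ w _); case: (nth _ w' _);
  by rewrite /= ?rmorphM ?rmorph1 ?mulr1 ?mul1r ?mulr0 ?mul0r.
Qed.

Lemma diag_Ycoef l : (l < size W)%N ->
  Ycoef R I W (I.+1 + l) * autV s (diag_scale l.+1)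
  = diag_scale l *
    (Ycoef R i w (i.+1 + (a + l)) * Ycoef R i' w' (i'.+1 + (b + l))).
Proof.
move=> lW; rewrite (diag_scaleS lW) mulrAC; congr (_ * _).
rewrite /Ycoef !letter_at_add (diag_letter D lW) /diag_ratio.
case: (nth _ w _); case: (nth _ w' _);
  by rewrite /= ?mulr1 ?mul1r ?mulr0 ?mul0r.
Qed.

End Diagonal.

Section DiagonalMap.
Variables (R : comNzRingType) (s : ring_aut R) (p : nat) (m0 : idealr R).
Variables (t t' : R) (i i' : nat) (w w' : seq letter).
Hypothesis s_order : forall r : R, iter p s r = r.
Variables (okV : string_ok s p m0 t i w) (okV' : string_ok s p m0 t' i' w').
Variables (I : nat) (W : seq letter) (a b : nat).
Hypothesis D : diagonal p i i' w w' I W a b.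

Local Notation V := (resR (string_mod okV)).
Local Notation V' := (resR (string_mod okV')).
Local Notation scale := (diag_scale s t t' w w' W a b).

Let left_mod := diag_left_mod D.
Let right_mod := diag_right_mod D.
Let left_leq := diag_left_leq D.
Let right_leq := diag_right_leq D.

Definition diag_pure (v : V) (v' : V') : string_space s m0 I W :=
  string_of s m0 I (w := W)
    (fun l => scale l * (coord_repr v (a + l) * coord_repr v' (b + l))).

Lemma rcoord_diag_pure v v' l : (l <= size W)%N ->
  rcoord (I.+1 + l) (diag_pure v v') l =
  residue _ (scale l) * (rcoord (I.+1 + l) v (a + l) * rcoord (I.+1 + l) v' (b + l)).
Proof. by move=> lW; rewrite (rcoord_string_of _ s_order) // !residueM. Qed.

Lemma actX_string (r : R) n u (ok : string_ok s p m0 r n u)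
  (v : resR (string_mod ok)) : actX v = stringX r v.
Proof. exact: gmod_X. Qed.

Lemma actY_string (r : R) n u (ok : string_ok s p m0 r n u)
  (v : resR (string_mod ok)) : actY v = stringY v.
Proof. exact: gmod_Y. Qed.

Lemma rcoord_resRD (r : R) n u (ok : string_ok s p m0 r n u)
    (v v' : resR (string_mod ok)) K k :
    (n.+1 + k = K %[mod p])%N -> (k <= size u)%N ->
  rcoord K (v + v') k = rcoord K v k + rcoord K v' k.
Proof. by move=> EK ku; have := rcoordD s_order EK ku v v'. Qed.

Lemma rcoord_resRZ (r : R) n u (ok : string_ok s p m0 r n u)
    c (v : resR (string_mod ok)) K k :
    (n.+1 + k = K %[mod p])%N -> (k <= size u)%N ->
  rcoord K (c *: v) k = residue _ c * rcoord K v k.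
Proof. by move=> EK ku; rewrite resR_stringZ (rcoordZ s_order). Qed.

Lemma diag_pureDl u v v' : diag_pure (u + v) v' = diag_pure u v' + diag_pure v v'.
Proof.
apply: rcoord_ext => l lW; rewrite (rcoordD s_order) // !rcoord_diag_pure //.
by rewrite rcoord_resRD ?left_leq ?left_mod // mulrDl mulrDr.
Qed.

Lemma diag_pureDr v u' v' : diag_pure v (u' + v') = diag_pure v u' + diag_pure v v'.
Proof.
apply: rcoord_ext => l lW; rewrite (rcoordD s_order) // !rcoord_diag_pure //.
by rewrite rcoord_resRD ?right_leq ?right_mod // !mulrDr.
Qed.

Lemma diag_pureZ r v v' : diag_pure (r *: v) v' = r *: diag_pure v v'.
Proof.
apply: rcoord_ext => l lW; rewrite (rcoordZ s_order) // !rcoord_diag_pure //.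
by rewrite rcoord_resRZ ?left_leq ?left_mod // -mulrA mulrCA.
Qed.

Lemma diag_pure_balanced r v v' : diag_pure (r *: v) v' = diag_pure v (r *: v').
Proof.
rewrite diag_pureZ.
apply: rcoord_ext => l lW; rewrite (rcoordZ s_order) // !rcoord_diag_pure //.
rewrite rcoord_resRZ ?right_leq ?right_mod //.
by rewrite mulrCA; congr (_ * _); rewrite mulrCA.
Qed.

Definition diag_map : tens V V' -> string_space s m0 I W := tens_lift diag_pure.

Lemma diag_map_pure v v' : diag_map (pure v v') = diag_pure v v'.
Proof.
exact: (tens_lift_pure diag_pureDl diag_pureDr diag_pure_balanced).
Qed.

Lemma diag_mapD : {morph diag_map : x y / x + y}.
Proof.
exact: (tens_liftD diag_pureDl diag_pureDr diag_pure_balanced).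
Qed.

Lemma diag_mapZ r x : diag_map (r *: x) = r *: diag_map x.
Proof.
move: x; apply: (tens_ext (g := fun x => diag_map (r *: x))
                          (h := fun x => r *: diag_map x)) => [x y|x y|v v'] /=.
- by rewrite scalerDr diag_mapD.
- by rewrite diag_mapD scalerDr.
by rewrite pureZ !diag_map_pure diag_pureZ.
Qed.

Lemma diag_mapX x :
  diag_map (tensX x) = stringX (t * t') (diag_map x).
Proof.
move: x; apply: (tens_ext (g := fun x => diag_map (tensX x))
  (h := fun x => stringX (t * t') (diag_map x))) => [x y|x y|v v'] /=.
- by rewrite tensXD diag_mapD.
- by rewrite diag_mapD stringXD.
rewrite tensX_pure !diag_map_pure !actX_string.
apply: rcoord_ext => -[|l] lW; rewrite rcoord_diag_pure //.
  rewrite [RHS](rcoord_stringX0 s_order) ?addn0 //; case: (diag_start D) => E.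
    have Ei : (i.+1 = I.+1 %[mod p])%N by have := left_mod 0; rewrite E !addn0.
    by rewrite E (rcoord_stringX0 s_order) // mul0r mulr0.
  have Ei : (i'.+1 = I.+1 %[mod p])%N by have := right_mod 0; rewrite E !addn0.
  by rewrite E (rcoord_stringX0 s_order) // !mulr0.
have kW := ltnW lW.
have aw := diag_left_ltn D lW; have bw := diag_right_ltn D lW.
have Ea : (i.+1 + (a + l).+1 = I.+1 + l.+1 %[mod p])%N by rewrite -addnS.
have Eb : (i'.+1 + (b + l).+1 = I.+1 + l.+1 %[mod p])%N by rewrite -addnS.
rewrite (addnS a) (addnS b) (rcoord_stringXS s_order) //.
rewrite (rcoord_stringXS s_order _ _ Eb) //.
rewrite [RHS](rcoord_stringXS s_order) //.
rewrite -!residueM; apply/esym.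
have E := congM (Xcoef s (t * t') I W (I.+1 + l))
  (cong_aut (coord_repr_string_of s m0 I _ kW)).
rewrite (residue_cong s_order (erefl _) (E _)) !rmorphM mulrA.
rewrite (diag_Xcoef _ _ _ D lW) -!mulrA; congr (residue _ (_ * (_ * _))).
by rewrite mulrCA.
Qed.

Lemma diag_mapY x : diag_map (tensY x) = stringY (diag_map x).
Proof.
move: x; apply: (tens_ext (g := fun x => diag_map (tensY x))
  (h := fun x => stringY (diag_map x))) => [x y|x y|v v'] /=.
- by rewrite tensYD diag_mapD.
- by rewrite diag_mapD stringYD.
rewrite tensY_pure !diag_map_pure !actY_string.
apply: rcoord_ext => l lW; rewrite rcoord_diag_pure //.
have [lW'|Wl] := ltnP l (size W); last first.
  have {lW Wl} -> : l = size W by apply/eqP; rewrite eqn_leq lW.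
  rewrite [RHS](rcoord_stringY_last s_order) //; case: (diag_stop D) => E.
    by rewrite E (rcoord_stringY_last s_order) -?E ?left_mod // mul0r mulr0.
  by rewrite E (rcoord_stringY_last s_order) -?E ?right_mod // !mulr0.
have aw := diag_left_ltn D lW'; have bw := diag_right_ltn D lW'.
rewrite (rcoord_stringY s_order _ (left_mod l)) //.
rewrite (rcoord_stringY s_order _ (right_mod l)) //.
rewrite [RHS](rcoord_stringY s_order) // -!residueM; apply/esym.
have E := congM (Ycoef R I W (I.+1 + l))
  (cong_autV (coord_repr_string_of s m0 I _ lW')).
rewrite (residue_cong s_order (erefl _) (E _)) !rmorphM mulrA.
rewrite (diag_Ycoef _ _ _ D lW') -!mulrA !addnS.
congr (residue _ (_ * (_ * _))).
by rewrite mulrCA.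
Qed.

End DiagonalMap.
Section TensorBasis.
Variables (R : comNzRingType) (M N : lmodType R).

Lemma pure0l (n : N) : pure (0 : M) n = 0.
Proof. by rewrite -(scale0r 0) -pureZ scale0r. Qed.

Lemma pureZr r (m : M) (n : N) : pure m (r *: n) = r *: pure m n.
Proof. by rewrite pureZ pure_balanced. Qed.

Lemma pure0r (m : M) : pure m (0 : N) = 0.
Proof. by rewrite -(scale0r 0) pureZr scale0r. Qed.

Lemma pure_suml (K : Type) (r : seq K) (P : pred K) (F : K -> M) (n : N) :
  pure (\sum_(k <- r | P k) F k) n = \sum_(k <- r | P k) pure (F k) n.
Proof.
apply: (big_morph (fun m => pure m n)) => [m m'|]; [exact: pureDl|exact: pure0l].
Qed.

Lemma pure_sumr (K : Type) (r : seq K) (P : pred K) (m : M) (F : K -> N) :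
  pure m (\sum_(k <- r | P k) F k) = \sum_(k <- r | P k) pure m (F k).
Proof.
apply: (big_morph (fun n => pure m n)) => [n n'|]; [exact: pureDr|exact: pure0r].
Qed.

Lemma pure_coprime (m m' : idealr R) (u : M) (v : N) x :
    wspace m u -> wspace m' v -> x \in m -> 1 - x \in m' -> pure u v = 0.
Proof.
move=> um vm xm xm'; rewrite -[LHS]scale1r -(subrK x 1) scalerDl.
by rewrite -pureZr vm // pure0r add0r pureZ um // pure0l.
Qed.

End TensorBasis.

Section DiagonalDecomposition.
Variables (R : comNzRingType) (s : ring_aut R) (p : nat) (m0 : idealr R).
Variables (t t' : R) (i i' : nat) (w w' : seq letter).
Hypothesis s_order : forall r : R, iter p s r = r.
Hypothesis m0_max : maximal_ideal m0.
Hypothesis orb_card : forall k l : nat, (k < p)%N -> (l < p)%N ->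
  orb s m0 k =i orb s m0 l -> k = l.
Variables (okV : string_ok s p m0 t i w) (okV' : string_ok s p m0 t' i' w').

Variables (J : finType) (I : J -> nat) (W : J -> seq letter) (a b : J -> nat).
Hypothesis D : forall j, diagonal p i i' w w' (I j) (W j) (a j) (b j).
Hypothesis cover : forall k k', (k <= size w)%N -> (k' <= size w')%N ->
  (i + k = i' + k' %[mod p])%N ->
  exists j l, [/\ (l <= size (W j))%N, k = (a j + l)%N & k' = (b j + l)%N].
Hypothesis disjoint_diag : forall j j' l l',
  (l <= size (W j))%N -> (l' <= size (W j'))%N ->
  (a j + l = a j' + l')%N -> (b j + l = b j' + l')%N -> j = j'.

Variable ok : forall j, string_ok s p m0 (t * t') (I j) (W j).

Local Notation V := (resR (string_mod okV)).
Local Notation V' := (resR (string_mod okV')).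
Local Notation T := (tens V V').
Local Notation N := (dsum (fun j => string_mod (ok j))).
Local Notation scale j := (diag_scale s t t' w w' (W j) (a j) (b j)).
Local Notation K j l := ((I j).+1 + l)%N.

Definition tens_base (k k' : nat) : T :=
  pure (base_vec s m0 i k : V) (base_vec s m0 i' k' : V').

Lemma base_wspace r n u (okU : string_ok s p m0 r n u) k :
  wspace (orb s m0 (n.+1 + k)) (base_vec s m0 n k : resR (string_mod okU)).
Proof. by move=> x xk; rewrite resR_stringZ (base_vec_killed s_order). Qed.

Lemma tens_base_wspace j l :
  wspace (orb s m0 (K j l)) (tens_base (a j + l) (b j + l)).
Proof.
move=> r rl; rewrite /tens_base pureZ base_wspace ?pure0l //.
by rewrite (mem_orb_eqmod m0 s_order _ (diag_left_mod (D j) l)).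
Qed.

Lemma tens_base0 k k' : (i + k <> i' + k' %[mod p])%N -> tens_base k k' = 0.
Proof.
move=> neq; have p_gt0 : (0 < p)%N by apply: leq_ltn_trans (string_lt okV).
have neq_orb : ~ orb s m0 (i.+1 + k) =i orb s m0 (i'.+1 + k').
  move=> /(orb_inj_mod s_order orb_card p_gt0)/eqP.
  by rewrite !addSn -!(addn1 (_ + _)) eqn_modDr => /eqP.
have [x xk xk'] := maximal_coprime (orb_maximal m0_max) (orb_maximal m0_max) neq_orb.
exact: (pure_coprime (@base_wspace _ _ _ okV k) (@base_wspace _ _ _ okV' k') xk xk').
Qed.

Lemma tens_base_ext (Z : zmodType) (g h : T -> Z) :
    {morph g : x y / x + y} -> {morph h : x y / x + y} ->
    (forall r k k', (k <= size w)%N -> (k' <= size w')%N ->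
       g (r *: tens_base k k') = h (r *: tens_base k k')) -> g =1 h.
Proof.
move=> gD hD gh; apply: tens_ext => // v v'.
have sumD (f : T -> Z) (n : nat) (F : 'I_n -> T) : {morph f : x y / x + y} ->
    f (\sum_k F k) = \sum_k f (F k).
  move=> fD; apply: (big_morph f fD).
  by apply: (addrI (f 0)); rewrite -fD !addr0.
have -> : pure v v' = \sum_(k < (size w).+1) \sum_(k' < (size w').+1)
    (coord_repr v' k' * coord_repr v k) *: tens_base k k'.
  rewrite {1}(string_expansion s_order v) [in LHS](string_expansion s_order v').
  rewrite pure_suml; apply: eq_bigr => k _.
  rewrite pure_sumr; apply: eq_bigr => k' _.
  rewrite -scalerA pureZ -pureZr; congr (pure _ _); exact/esym/resR_stringZ.
rewrite !sumD //; apply: eq_bigr => k _; rewrite !sumD //.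
by apply: eq_bigr => k' _; apply: gh; rewrite -ltnS ltn_ord.
Qed.

Definition component (z : N) (j : J) : string_space s m0 (I j) (W j) := z j.
Arguments component : clear implicits.

Definition diags (x : T) : N := fun j => diag_map (I j) (W := W j) (a j) (b j) x.

Lemma diagsD : {morph diags : x y / x + y}.
Proof. by move=> x y; apply: dsumP => j; apply: (diag_mapD s_order (D j)). Qed.

Lemma rcoord_diags_base r k k' j l : (l <= size (W j))%N ->
  rcoord (K j l) (component (diags (r *: tens_base k k')) j) l
  = residue _ (r * scale j l) * ((a j + l == k) && (b j + l == k'))%N%:R.
Proof.
move=> lW; rewrite /component /diags (diag_mapZ s_order (D j)) (rcoordZ s_order) //.
rewrite (diag_map_pure s_order (D j)) (rcoord_diag_pure s_order) // residueM -mulrA.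
have [aw bw] := (diag_left_leq (D j) lW, diag_right_leq (D j) lW).
rewrite (rcoord_base_vec _ s_order (diag_left_mod (D j) l)) //.
rewrite (rcoord_base_vec _ s_order (diag_right_mod (D j) l)) //.
by congr (_ * (_ * _)); case: eqP; case: eqP; rewrite ?mulr0 ?mulr1.
Qed.

Lemma diag_scale_inv : exists inv : J -> nat -> R, forall j l,
  (l <= size (W j))%N -> residue (orb s m0 (K j l)) (scale j l * inv j l) = 1.
Proof.
have /choice[inv invP] (jl : J * nat) : exists r, (jl.2 <= size (W jl.1))%N ->
    residue (orb s m0 (K jl.1 jl.2)) (scale jl.1 jl.2 * r) = 1.
  case: jl => j l /=; have [lW|_] := leqP l (size (W j)); last by exists 0.
  have lunit := diag_scale_notin s_order m0_max okV okV' (D j) lW.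
  have [r rP] := maximal_inv (orb_maximal m0_max) lunit.
  by exists r => _; rewrite -residue1; apply/residue_eq.
by exists (fun j l => inv (j, l)) => j l lW; apply: (invP (j, l)).
Qed.

Lemma diags_bij : bijective diags.
Proof.
have [inv invP] := diag_scale_inv.
pose term (z : N) j l : T := (inv j l * coord_repr (component z j) l)
  *: tens_base (a j + l) (b j + l).
pose G (z : N) : T := \sum_j \sum_(l < (size (W j)).+1) term z j l.
have termE z j l r : (l <= size (W j))%N ->
    residue (orb s m0 (K j l)) (inv j l) * rcoord (K j l) (component z j) l
      = residue _ r ->
    term z j l = r *: tens_base (a j + l) (b j + l).
  move=> lW E; apply: (wspaceZ_eq (@tens_base_wspace j l)).
  by rewrite residueM.
have GD : {morph G : y z / y + z}.
  move=> y z; rewrite /G -big_split; apply: eq_bigr => j _ /=.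
  rewrite -big_split; apply: eq_bigr => l _ /=.
  rewrite -scalerDl; apply: termE; first by rewrite -ltnS.
  have -> : component (y + z) j = component y j + component z j by [].
  by rewrite (rcoordD s_order) -1?ltnS // residueD !residueM mulrDr.
exists G => [x|z].
  move: x; apply: tens_base_ext => [x y|//|r k k' kw kw'].
    by rewrite diagsD GD.
  have [/eqP E|/eqP neq] := boolP (i + k == i' + k' %[mod p])%N; last first.
    rewrite tens_base0 // scaler0; apply: (addrI (G (diags 0))).
    by rewrite -GD -diagsD !addr0.
  have [j [l [lW Ek Ek']]] := cover kw kw' E.
  rewrite /G (bigD1 j) //= (bigD1 (Ordinal (lW : (l < _.+1)%N))) //=.
  rewrite (termE _ _ _ r) // -?Ek -?Ek'; last first.
    rewrite rcoord_diags_base // -Ek -Ek' !eqxx mulr1 residueM mulrCA -residueM.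
    by rewrite [inv _ _ * _]mulrC invP // mulr1.
  rewrite !big1 ?addr0 // => [j' jj'|l' ll'].
    rewrite big1 // => l' _; rewrite (termE _ _ _ 0) ?scale0r -1?ltnS //.
    rewrite rcoord_diags_base -1?ltnS // residue0.
    case: andP => [[/eqP Ea /eqP Eb]|_]; last by rewrite !mulr0.
    case/eqP: jj'; apply: (disjoint_diag (l := l') (l' := l)) => //.
    - by rewrite -ltnS.
    - by rewrite Ea.
    - by rewrite Eb.
  rewrite (termE _ _ _ 0) ?scale0r -1?ltnS //.
  rewrite rcoord_diags_base -1?ltnS // residue0.
  case: andP => [[/eqP Ea _]|_]; last by rewrite !mulr0.
  by case/eqP: ll'; apply: val_inj; apply: (@addnI (a j)); rewrite Ea.
apply: dsumP => j; apply: rcoord_ext => l lW.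
pose h x := rcoord (K j l) (component (diags x) j) l.
have hD : {morph h : x y / x + y}.
  move=> x y; rewrite /h -(rcoordD s_order) //.
  by congr (rcoord _ _ _); rewrite diagsD.
have h0 : h 0 = 0 by apply: (addrI (h 0)); rewrite -hD !addr0.
rewrite -[LHS]/(h (G z)) /G (big_morph h hD h0) (bigD1 j) //=.
rewrite (big_morph h hD h0) (bigD1 (Ordinal (lW : (l < _.+1)%N))) //=.
rewrite {1}/h rcoord_diags_base // !eqxx mulr1 mulrAC residueM.
rewrite [inv _ _ * _]mulrC invP // mul1r !big1 ?addr0 // => [j' jj'|l' ll'].
  rewrite (big_morph h hD h0) big1 // => l' _; rewrite /h rcoord_diags_base //.
  case: andP => [[/eqP Ea /eqP Eb]|_]; last by rewrite mulr0.
  case/eqP: jj'; apply/esym/(disjoint_diag (l := l) (l' := l')) => //.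
  by rewrite -ltnS.
rewrite /h rcoord_diags_base //.
case: andP => [[/eqP /addnI Ea _]|_]; last by rewrite mulr0.
by case/eqP: ll'; apply: val_inj; rewrite /= -Ea.
Qed.

Lemma dsum_scaleE (c : gwa s (t * t')) (z : N) j : (c *: z) j = c *: z j.
Proof. by []. Qed.

Lemma string_tensor_iso : lmod_iso (gtens (string_mod okV) (string_mod okV')) N.
Proof.
pose f : gtens (string_mod okV) (string_mod okV') -> N := diags.
apply: (@lmod_iso_linear _ _ _ f); last exact: diags_bij.
have scal : scalable f.
  apply: gwa_scalable => [x y|r x|x|x]; first exact: diagsD.
  - rewrite gmod_C; apply: dsumP => j; rewrite dsum_scaleE [RHS]gmod_C.
    exact: (diag_mapZ s_order (D j)).
  - rewrite gmod_X; apply: dsumP => j; rewrite dsum_scaleE [RHS]gmod_X.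
    exact: (diag_mapX s_order (D j)).
  - rewrite gmod_Y; apply: dsumP => j; rewrite dsum_scaleE [RHS]gmod_Y.
    exact: (diag_mapY s_order (D j)).
by move=> c x y; rewrite -scal; apply: diagsD.
Qed.

End DiagonalDecomposition.

Lemma count_progression (a n p : nat) : (0 < p)%N ->
  exists c, forall j, (j < c)%N = (a + j * p <= n)%N.
Proof.
move=> p_gt0; have [an|na] := leqP a n.
  by exists ((n - a) %/ p).+1 => j; rewrite ltnS leq_divRL // leq_subRL.
by exists 0%N => j; rewrite ltn0; apply/esym/negbTE; rewrite -ltnNge ltn_addr.
Qed.

Lemma string_wdim (R : comNzRingType) (s : ring_aut R) (p : nat)
    (m0 : idealr R) (t : R) (i : nat) (w : seq letter) (c K a : nat)
    (ok : string_ok s p m0 t i w) :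
    (forall r : R, iter p s r = r) -> maximal_ideal m0 ->
    (forall k l : nat, (k < p)%N -> (l < p)%N ->
       orb s m0 k =i orb s m0 l -> k = l) ->
    wdim (orb s m0 K) (resR (string_mod ok)) c ->
    (i.+1 + a = K %[mod p])%N -> (a < p)%N ->
  forall j, (j < c)%N = (a + j * p <= size w)%N.
Proof.
move=> s_order m0_max orb_card dim_c EK lt_ap.
have p_gt0 : (0 < p)%N by apply: leq_ltn_trans lt_ap.
have [n nE] := count_progression a (size w) p_gt0.
have dim_n := string_space_wdim s_order m0_max orb_card p_gt0 EK lt_ap nE.
by rewrite (wdim_unique dim_c (wdim_iso (resR_string_iso ok) dim_n)).
Qed.

Section WordDiagonals.
Variables (p i i' : nat) (w w' : seq letter) (c c'' : nat).
Hypotheses (le_ii' : (i <= i')%N) (lt_i'p : (i' < p)%N).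
Hypothesis countP : forall j, (j < c)%N = (i' - i + j * p <= size w)%N.
Hypothesis count'P : forall j, (j < c'')%N = (i + j.+1 * p - i' <= size w')%N.

Local Notation J := ('I_c + 'I_c'')%type.

Definition word_start (x : J) : nat :=
  match x with inl _ => i' | inr _ => i end.
Definition word_of (x : J) : seq letter :=
  match x with
  | inl j => word_w' p i i' w w' j
  | inr j => word_w p i i' w w' j.+1
  end.
Definition left_offset (x : J) : nat :=
  match x with inl j => (i' - i + j * p)%N | inr _ => 0%N end.
Definition right_offset (x : J) : nat :=
  match x with inl _ => 0%N | inr j => (i + j.+1 * p - i')%N end.

Lemma word_diagonal x :
  diagonal p i i' w w' (word_start x) (word_of x) (left_offset x) (right_offset x).
Proof.
case: x => j; split; rewrite /= ?size_mkseq /len_m /len_n.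
- by [].
- by rewrite addnA subnKC // addnC modnMDl.
- by rewrite addn0.
- by have := countP j; rewrite ltn_ord => /esym; lia.
- lia.
- by right.
- by have := countP j; rewrite ltn_ord => /esym; lia.
- move=> l lW; rewrite nth_mkseq // /letter_at;
  congr (letter_mul (nth _ _ _) (nth _ _ _)); lia.
- lia.
- by rewrite addn0.
- have -> : (i' + (i + j.+1 * p - i') = j.+1 * p + i)%N.
    by rewrite mulSn; move: (j * p)%N => q; lia.
  by rewrite modnMDl.
- lia.
- by have := count'P j; rewrite ltn_ord => /esym; lia.
- by left.
- by have := count'P j; rewrite ltn_ord => /esym; lia.
- move=> l lW; rewrite nth_mkseq // /letter_at; rewrite mulSn.
  congr (letter_mul (nth _ _ _) (nth _ _ _)); move: (j * p)%N => q; lia.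
Qed.

Lemma word_diagonal_cover k k' : (k <= size w)%N -> (k' <= size w')%N ->
  (i + k = i' + k' %[mod p])%N ->
  exists x l, [/\ (l <= size (word_of x))%N,
    k = (left_offset x + l)%N & k' = (right_offset x + l)%N].
Proof.
move=> kw kw' E; have [le|lt] := leqP (i' + k') (i + k).
  have /dvdnP[q Eq] : (p %| i + k - (i' + k'))%N by rewrite -eqn_mod_dvd // E.
  have qc : (q < c)%N by rewrite countP; lia.
  exists (inl (Ordinal qc)), k'; rewrite /= size_mkseq /len_m.
  by split; lia.
have /dvdnP[[|q] Eq] : (p %| i' + k' - (i + k))%N.
- by rewrite -eqn_mod_dvd ?E // ltnW.
- by move: lt Eq; lia.
have qc : (q < c'')%N by rewrite count'P; lia.
have le_p : (p <= q.+1 * p)%N by rewrite mulSn leq_addr.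
exists (inr (Ordinal qc)), k; rewrite /= size_mkseq /len_n.
by split; lia.
Qed.

Lemma word_diagonal_disjoint x y l l' :
    (left_offset x + l = left_offset y + l')%N ->
    (right_offset x + l = right_offset y + l')%N -> x = y.
Proof.
have le_p q : (p <= q.+1 * p)%N by rewrite mulSn leq_addr.
have p_gt0 : (0 < p)%N by apply: leq_ltn_trans lt_i'p.
have mul_inj q q' : (q * p = q' * p)%N -> q = q'.
  by move/eqP; rewrite eqn_pmul2r // => /eqP.
case: x y => j [] j' /= Ea Eb.
- congr inl; apply/val_inj/mul_inj => /=; lia.
- by have := le_p j'; lia.
- by have := le_p j; lia.
congr inr; apply/val_inj/succn_inj/mul_inj => /=.
by have := le_p j; have := le_p j'; lia.
Qed.

End WordDiagonals.

Theorem lemma3p13 (R : comNzRingType) (s : ring_aut R) (p : nat)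
    (m0 : idealr R) (t t' : R) (i i' : nat) (w w' : seq letter) (c c' : nat)
    (s_order : forall r : R, iter p s r = r)
    (m0_max : maximal_ideal m0)
    (orb_card : forall k l : nat, (k < p)%N -> (l < p)%N ->
       orb s m0 k =i orb s m0 l -> k = l)
    (t_reg : GRing.lreg t) (t'_reg : GRing.lreg t')
    (le_ii' : (i <= i')%N) (lt_i'p : (i' < p)%N)
    (okV : string_ok s p m0 t i w) (okV' : string_ok s p m0 t' i' w')
    (dimV : wdim (orb s m0 i'.+1) (resR (string_mod okV)) c)
    (dimV' : wdim (orb s m0 i.+1) (resR (string_mod okV')) c') :
  exists (ok' : forall j : 'I_c,
            string_ok s p m0 (t * t') i' (word_w' p i i' w w' j))
         (ok : forall j : 'I_(c' - (i == i')),
            string_ok s p m0 (t * t') i (word_w p i i' w w' j.+1)),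
    lmod_iso (gtens (string_mod okV) (string_mod okV'))
             (dsum (fun j : 'I_c => string_mod (ok' j))
              * dsum (fun j : 'I_(c' - (i == i')) => string_mod (ok j)))%type.
Proof.
have p_gt0 : (0 < p)%N by apply: leq_ltn_trans lt_i'p.
have countP : forall j, (j < c)%N = (i' - i + j * p <= size w)%N.
  apply: (string_wdim s_order m0_max orb_card dimV); last lia.
  by rewrite addSn subnKC.
have count'P : forall j, (j < c' - (i == i'))%N = (i + j.+1 * p - i' <= size w')%N.
  have dimV'P a := @string_wdim _ _ _ _ _ _ _ _ _ a _ s_order m0_max orb_card dimV'.
  move=> j; have [Ei|ne] := eqVneq i i'.
    rewrite ltn_subRL add1n (dimV'P 0%N) ?addn0 ?Ei // add0n.
    by rewrite addKn.
  rewrite subn0 (dimV'P (i + p - i')%N); first by rewrite mulSn; lia.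
    by rewrite addSn subnKC -?addSn ?modnDr //; lia.
  lia.
have D := word_diagonal le_ii' lt_i'p countP count'P.
have ok x := diag_ok s_order m0_max okV okV' (D x).
exists (fun j => ok (inl j)), (fun j => ok (inr j)).
apply: lmod_iso_trans (dsum_sum_iso (fun x => string_mod (ok x))).
have cover := word_diagonal_cover le_ii' lt_i'p countP count'P.
apply: (string_tensor_iso s_order m0_max orb_card okV okV' D cover).
by move=> x y l l' _ _; apply: word_diagonal_disjoint.
Qed.
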